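(* (i) For all $\beta\in[0,1/2]$ and all $f\in L^2([0,1))$, $$\dim_{\mathcal P}\big(\mathcal E^+_{\rm HE}(\beta,f)\big)\le1-2\beta .$$ (ii) There exists a nonnegative function $f\in L^2([0,1))$ such that, for all $\beta\in[0,1/2]$, $$\dim_{\mathcal H}\big(E_{\rm HE}(\beta,f)\big)=\dim_{\mathcal P}\big(E_{\rm HE}(\beta,f)\big)=1-2\beta .$$ (iii) For quasi-all functions $f\in L^2([0,1))$, for all $\beta\in[0,1/2]$, $$\dim_{\mathcal H}\big(E^-_{\rm HE}(\beta,f)\big)=1-2\beta .$$
   Context: $\Lambda_i$ is the set of dyadic intervals of $[0,1)$ of generation $i$ (length $2^{-i}$), $\Lambda=\bigcup_{i\ge0}\Lambda_i$, $\varphi=\mathbf 1_{[0,1)}$, and $(\psi_\mu)_{\mu\in\Lambda}$ are the standard Haar functions with $L^\infty$-normalization ($\psi_\mu=1$ on the left half of $\mu$, $-1$ on the right half, $0$ elsewhere), so that $\varphi$ together with $(2^{i/2}\psi_\mu)_{i\ge0,\mu\in\Lambda_i}$ is an orthonormal basis of $L^2([0,1))$. For $j\ge1$ the $j$-th partial sum of the Haar expansion of $f$ is $$T_jf=\langle f,\varphi\rangle\varphi+\sum_{i=0}^{j-1}\sum_{\mu\in\Lambda_i}2^{i}\langle f,\psi_\mu\rangle\psi_\mu ,$$ i.e. the orthogonal projection of $f$ on the span of $(\mathbf 1_\lambda)_{\lambda\in\Lambda_j}$ (a function defined at every point of $[0,1)$). With $\log0=-\infty$, $$E^-_{\rm HE}(\beta,f)=\Big\{x\in[0,1):\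 \limsup_{j\to+\infty}\tfrac{\log|T_jf(x)|}{j\log2}=\beta\Big\},\quad \mathcal E^+_{\rm HE}(\beta,f)=\Big\{x\in[0,1):\ \liminf_{j\to+\infty}\tfrac{\log|T_jf(x)|}{j\log2}\ge\beta\Big\},$$ $$E_{\rm HE}(\beta,f)=\Big\{x\in[0,1):\ \lim_{j\to+\infty}\tfrac{\log|T_jf(x)|}{j\log2}=\beta\Big\}.$$ $\dim_{\mathcal H}$, $\dim_{\mathcal P}$ are Hausdorff and packing dimension (the empty set has dimension $0$). ''Quasi-all'' means: for all $f$ in a residual subset (one containing a countable intersection of dense open sets). *)

(* Defs.v *)
From HB Require Import structures.
From mathcomp Require Import all_boot all_order all_algebra.
From mathcomp Require Import all_classical all_reals all_analysis.
From mathcomp Require Import measurable_realfun borel_hierarchy.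

Set Implicit Arguments.
Unset Strict Implicit.
Unset Printing Implicit Defensive.

Import Order.TTheory GRing.Theory Num.Theory.
Import numFieldNormedType.Exports.

Local Open Scope classical_set_scope.
Local Open Scope ring_scope.

Section dimensions.
Context {R : realType}.
Implicit Types (A U : set R) (s delta : R).
Local Open Scope ereal_scope.

(* The added 0 makes [diam set0 = 0]. *)
Definition diam U : \bar R :=
  ereal_sup (0 |` [set `|x - y|%:E | x in U & y in U]).

(* The s-dimensional (pre)measures below are only used for s > 0, so that
   empty covering sets contribute 0 `^ s = 0. *)
Definition hausdorff_premeasure s delta A : \bar R :=
  ereal_inf [set \sum_(k <oo) diam (U k) `^ s | U in
    [set U : (set R)^nat |
      A `<=` \bigcup_k U k /\ forall k, diam (U k) <= delta%:E]].

Definition hausdorff_measure s A : \bar R :=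
  ereal_sup [set hausdorff_premeasure s delta A | delta in [set d | (0 < d)%R]].

Definition hausdorff_dim A : \bar R :=
  ereal_inf [set s%:E | s in [set s | (0 < s)%R /\ hausdorff_measure s A = 0]].

(* A packing consists of the pairwise disjoint closed balls of centers x i and
   radii r i for i in D; it is finite or countable, possibly empty. *)
Definition is_packing delta A (D : set nat) (x r : nat -> R) : Prop :=
  (forall i, D i -> A (x i) /\ (0 < r i <= delta)%R) /\
  trivIset D (fun i => closed_ball (x i) (r i)).

Definition packing_premeasure_delta s delta A : \bar R :=
  ereal_sup [set v | exists D x r, is_packing delta A D x r /\
    v = \esum_(i in D) diam (closed_ball (x i) (r i)) `^ s].

Definition packing_premeasure s A : \bar R :=
  ereal_inf [set packing_premeasure_delta s delta A |
    delta in [set d | (0 < d)%R]].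

Definition packing_measure s A : \bar R :=
  ereal_inf [set \sum_(k <oo) packing_premeasure s (F k) | F in
    [set F : (set R)^nat | A `<=` \bigcup_k F k]].

Definition packing_dim A : \bar R :=
  ereal_inf [set s%:E | s in [set s | (0 < s)%R /\ packing_measure s A = 0]].

End dimensions.

Definition residual (T : topologicalType) (A : set T) : Prop :=
  exists2 G, Gdelta_dense G & G `<=` A.

Section L2_unit_interval.
Variable R : realType.

Definition measurable_unit_itv :
    measurable (`[0%R, 1%R[%classic : set (measurableTypeR R)) :=
  measurable_itv `[0, 1[.

(* Lebesgue measure of [0,1), seen as a measure on R supported by [0,1). *)
Definition lebesgue01 : {measure set (measurableTypeR R) -> \bar R} :=
  mrestr (@lebesgue_measure R) measurable_unit_itv.

(* Classes of real functions for equality a.e. on [0,1); a class coerces to one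
   of its representatives. *)
Definition L2 : Type := LspaceType2 lebesgue01.

HB.instance Definition _ := gen_eqMixin L2.
HB.instance Definition _ := gen_choiceMixin L2.

Definition L2_repr (f : L2) : {mfun measurableTypeR R >-> measurableTypeR R} :=
  repr (LebesgueSpace.sort f).
Coercion L2_repr : L2 >-> MeasurableFun.type.

Definition L2_dist (f g : L2) : R :=
  fine ('N[lebesgue01]_2%:E[EFin \o (f \- g)%R])%E.

Local Notation "'N_2 [ f ]" := ('N[lebesgue01]_2%:E[EFin \o f%R])%E.

Lemma measurable_L2 (f : L2) : measurable_fun setT f.
Proof. exact: measurable_funPT (L2_repr f). Qed.

Lemma measurable_L2B (f g : L2) : measurable_fun setT (f \- g).
Proof. by apply: measurable_funB; exact: measurable_L2. Qed.

Lemma Lnorm_L2_sym (f g : measurableTypeR R -> R) :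
  'N_2 [f \- g] = 'N_2 [g \- f].
Proof.
rewrite -[RHS]oppe_Lnorm; congr Lnorm; apply/funext => x /=.
by rewrite opprB.
Qed.

Lemma L2_distE (f g : L2) : (L2_dist f g)%:E = 'N_2 [f \- g].
Proof.
rewrite /L2_dist fineK// ge0_fin_numE ?Lnorm_ge0//.
have Nf (h : L2) : ('N_2 [h] < +oo)%E by exact: Lebesgue_finite.
have := eminkowski lebesgue01 (measurable_L2 f)
  (measurableT_comp (@oppr_measurable R setT) (measurable_L2 g)) (lee1n 2).
rewrite (_ : 'N_2 [(-%R \o g)] = 'N_2 [g]); last by rewrite -[RHS]oppe_Lnorm.
by move=> /le_lt_trans; apply; rewrite lte_add_pinfty.
Qed.

Lemma L2_distxx (f : L2) : L2_dist f f = 0.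
Proof.
apply: EFin_inj; rewrite L2_distE (_ : _ \o _ = cst 0%E).
  by rewrite Lnorm0.
by apply/funext => x /=; rewrite subrr.
Qed.

Lemma L2_dist_sym (f g : L2) : L2_dist f g = L2_dist g f.
Proof. by rewrite /L2_dist Lnorm_L2_sym. Qed.

Lemma L2_dist_triangle (g f h : L2) : L2_dist f h <= L2_dist f g + L2_dist g h.
Proof.
rewrite -lee_fin EFinD !L2_distE.
have := eminkowski lebesgue01 (measurable_L2B f g) (measurable_L2B g h)
  (lee1n 2).
apply: le_trans; rewrite le_eqVlt; apply/orP; left; apply/eqP; congr Lnorm.
by apply/funext => x /=; rewrite addrA subrK.
Qed.

Lemma L2_dist_eq0 (f g : L2) : L2_dist f g = 0 -> f = g.
Proof.
move=> fg0.
have fg : f = g %[ae lebesgue01].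
  have mfg : measurable_fun setT (EFin \o (f \- g)).
    by apply: measurableT_comp => //; exact: measurable_L2B.
  have p0 : (0 < 2%:E :> \bar R)%E by [].
  have fg0' : 'N_2 [f \- g] = 0%E by rewrite -L2_distE fg0.
  have := Lnorm_eq0_eq0 mfg p0 fg0'.
  by apply: filterS => x /(_ I) /= [/eqP]; rewrite subr_eq0 => /eqP.
move: f g fg {fg0} => [f [[Hf]]] [g [[Hg]]] /=.
rewrite /L2_repr /= => fg.
have E : f = g.
  rewrite -[f]reprK -[g]reprK; apply/eqP.
  by rewrite eqmodE; exact/asboolP.
by move: E Hf Hg {fg} => -> Hf Hg; rewrite (Prop_irrelevance Hf Hg).
Qed.

HB.instance Definition _ :=
  isMetric.Build R L2 L2_distxx L2_dist_eq0 L2_dist_sym L2_dist_triangle.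

End L2_unit_interval.

Section haar_expansion.
Context {R : realType}.
Implicit Types (f : R -> R) (i j k : nat) (x beta : R).

(* The intervals of Lambda_i are the [dyadic_itv i k] for k < 2 ^ i. *)
Definition dyadic_itv i k : set R :=
  `[k%:R / 2 ^+ i, k.+1%:R / 2 ^+ i[%classic.

Definition haar_phi : R -> R := \1_(`[0, 1[%classic : set R).

(* The two halves of [dyadic_itv i k] are its dyadic children. *)
Definition haar_psi i k x : R :=
  \1_(dyadic_itv i.+1 k.*2) x - \1_(dyadic_itv i.+1 k.*2.+1) x.

Definition L2_inner (f g : R -> R) : R := \int[lebesgue01 R]_x (f x * g x).

Definition haar_sum j f x : R :=
  L2_inner f haar_phi * haar_phi x +
  \sum_(0 <= i < j) \sum_(0 <= k < 2 ^ i)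
    2 ^+ i * L2_inner f (haar_psi i k) * haar_psi i k x.

(* [lne 0 = -oo]; the value at j = 0 is irrelevant for the limits below. *)
Definition haar_rate f x : (\bar R)^nat := fun j =>
  (lne `|haar_sum j f x|%:E * ((j%:R * ln 2)^-1)%:E)%E.

Definition E_minus beta f : set R :=
  [set x | `[0, 1[%classic x /\ limn_esup (haar_rate f x) = beta%:E].

Definition E_plus beta f : set R :=
  [set x | `[0, 1[%classic x /\ (beta%:E <= limn_einf (haar_rate f x))%E].

Definition E_lim beta f : set R :=
  [set x | `[0, 1[%classic x /\ haar_rate f x @ \oo --> beta%:E].

End haar_expansion.

(* Main.v *)
From HB Require Import structures.
Require Import Defs.
From mathcomp Require Import all_boot all_order all_algebra.
From mathcomp Require Import all_classical all_reals all_analysis.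
From mathcomp Require Import measurable_realfun.
From mathcomp Require Import lra ring zify.

(* On a dyadic interval of generation j, T_j f is the mean of f, so by Bessel at
   most ||f||^2 2^(j (1 - 2c)) of these intervals carry |T_j f| >= 2^(c j).
   Covering by them bounds the Hausdorff measure of the points where this occurs
   infinitely often, and the packing measure of those where it occurs eventually.

   For the lower bounds let K_a, with a = 1 - 2 beta, be the set of points whose
   binary digits vanish at the positions i with u_i >= a, where u is the van der
   Corput sequence.  Free positions have density a, uniformly in a, hence the
   image of Lebesgue measure on K_a gives a dyadic interval of generation j a mass
   at most 2^(- a j + o(j)), and K_a has dimension a.  Since the sets of positions
   are nested in a, the sum Q_j of the densities of these measures at generation j,
   over a grid of j + 3 values of a, satisfies int Q_j = j + 3 and
   Q_j >= 2^(2 beta j - o(j)) on K_a for all beta at once.  A function dominating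
   all the Q_j^(1/2), up to polynomial factors, proves (ii); adding eta Q_j^(1/2)
   with the sign of T_j f on each interval, which never decreases |T_j f|, makes
   any f as large as needed at generation j, which proves (iii).  In both cases
   the upper bound on the growth rate holds almost everywhere on K_a, because the
   exceptional set is a countable union of sets that are null for Hausdorff
   measures of dimensions less than a. *)

Import Order.TTheory GRing.Theory Num.Theory.
Import numFieldNormedType.Exports.
(* [all_analysis] has another [dyadic_itv]. *)
Import Defs.

Set Implicit Arguments.
Unset Strict Implicit.
Unset Printing Implicit Defensive.

Local Open Scope classical_set_scope.
Local Open Scope ring_scope.

(** * Dyadic intervals and digit insertion *)

Section dyadic_index.
Context {R : realType}.
Implicit Types (x y t : R) (i j k : nat).

Definition dyadic_index j x : nat := Num.truncn (2 ^+ j * x).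

Definition unit_itv : set R := `[0, 1[%classic.

Lemma unit_itvP x : unit_itv x <-> 0 <= x < 1.
Proof. by rewrite /unit_itv /= in_itv. Qed.

Lemma dyadic_itvP j k x :
  dyadic_itv j k x <-> k%:R <= 2 ^+ j * x < k.+1%:R.
Proof.
rewrite /dyadic_itv /= in_itv /=.
have j0 : 0 < 2 ^+ j :> R by rewrite exprn_gt0.
by rewrite ler_pdivrMr// ltr_pdivlMr// mulrC.
Qed.

Lemma dyadic_indexP j k x : 0 <= x -> dyadic_itv j k x <-> dyadic_index j x = k.
Proof.
move=> x0; rewrite dyadic_itvP /dyadic_index; split=> [|<-].
  by move=> H; apply/eqP; rewrite truncn_eq// mulr_ge0// exprn_ge0.
by rewrite truncn_itv// mulr_ge0// exprn_ge0.
Qed.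

Lemma dyadic_index_itv j x : 0 <= x ->
  (dyadic_index j x)%:R <= 2 ^+ j * x < (dyadic_index j x).+1%:R.
Proof. by move=> x0; apply/dyadic_itvP/dyadic_indexP. Qed.

Lemma dyadic_index_lt j x : unit_itv x -> (dyadic_index j x < 2 ^ j)%N.
Proof.
move=> /unit_itvP/andP[x0 x1]; have /andP[+ _] := dyadic_index_itv j x0.
move=> /le_lt_trans H; rewrite -(ltr_nat R) natrX; apply: H.
by rewrite gtr_pMr// exprn_gt0.
Qed.

Lemma dyadic_index_half j x : 0 <= x ->
  (dyadic_index j.+1 x)./2 = dyadic_index j x.
Proof.
move=> x0; apply/esym/eqP; rewrite truncn_eq ?mulr_ge0 ?exprn_ge0//.
have := dyadic_index_itv j.+1 x0; rewrite exprS -mulrA.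
set n := dyadic_index _ _; set y := 2 ^+ j * x => /andP[H1 H2].
have E : n%:R = (odd n)%:R + 2 * (n./2)%:R :> R.
  by rewrite -[in LHS](odd_double_half n) natrD -mul2n natrM.
move: H1 H2; rewrite -!natr1 E; case: (odd n) => /= H1 H2; apply/andP; split; lra.
Qed.

Lemma dyadic_itv_unit j k x : (k < 2 ^ j)%N -> dyadic_itv j k x -> unit_itv x.
Proof.
move=> kj /dyadic_itvP/andP[H1 H2]; have j0 : 0 < 2 ^+ j :> R by rewrite exprn_gt0.
apply/unit_itvP; rewrite -(pmulr_rge0 _ j0) (le_trans _ H1)//=.
by rewrite -(ltr_pM2l j0) mulr1 (lt_le_trans H2)// -natrX ler_nat.
Qed.

Lemma dyadic_itv_split j k :
  dyadic_itv j k = dyadic_itv j.+1 k.*2 `|` dyadic_itv j.+1 k.*2.+1 :> set R.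
Proof.
apply/seteqP; split=> x.
  move=> /dyadic_itvP H.
  have [H'|H'] := ltP (2 ^+ j.+1 * x) k.*2.+1%:R; [left|right];
    apply/dyadic_itvP; apply/andP; split => //;
    move: H; rewrite exprS -mulrA; move: (2 ^+ j * x) => y;
    rewrite -?doubleS -!mul2n ?natrM; lra.
by case=> /dyadic_itvP H; apply/dyadic_itvP; move: H; rewrite exprS -mulrA;
  move: (2 ^+ j * x) => y; rewrite -?doubleS -!mul2n ?natrM -!natr1 ?natrM; lra.
Qed.

Lemma dyadic_itv_disj j k k' x :
  dyadic_itv j k x -> dyadic_itv j k' x -> k = k'.
Proof.
move=> /dyadic_itvP/andP[a b] /dyadic_itvP/andP[c d].
have := le_lt_trans a d; have := le_lt_trans c b.
by rewrite !ltr_nat !ltnS => ? ?; apply/eqP; rewrite eqn_leq; apply/andP.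
Qed.

(** Digits read off half-open intervals are never eventually all 1: otherwise the intervals around
    [t] of generations [j + n] would share their right end, and the gap between it and [t], which is
    positive, would be at most 2^-(j+n) for every [n]. *)
Lemma dyadic_index_ones t j : 0 <= t ->
  exists2 i, (j <= i)%N & ~~ odd (dyadic_index i.+1 t).
Proof.
move=> t0; apply: contrapT => H.
have H' n : (dyadic_index (j + n) t).+1 = (2 ^ n * (dyadic_index j t).+1)%N.
  elim: n => [|n IH]; first by rewrite addn0 mul1n.
  rewrite addnS -[dyadic_index (j + n).+1 t]odd_double_half dyadic_index_half//.
  have -> : odd (dyadic_index (j + n).+1 t).
    by apply/negPn/negP => ?; apply: H; exists (j + n)%N; rewrite ?leq_addr.
  by rewrite /= add1n -doubleS IH -mul2n mulnA expnS.
have /andP[_] := dyadic_index_itv j t0.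
set a := dyadic_index j t => lta.
pose d := a.+1%:R - 2 ^+ j * t; have d0 : 0 < d by rewrite subr_gt0.
have [n nd] : exists n, 1 < d * 2 ^+ n.
  exists (Num.truncn d^-1).+1; rewrite -ltr_pdivrMl// mulr1.
  apply: (@lt_le_trans _ _ (Num.truncn d^-1).+1%:R).
    by have /andP[] := truncn_itv (ltW (eqbRL (invr_gt0 _) d0)).
  by rewrite -natrX ler_nat ltnW// ltn_expl.
have /andP[+ _] := dyadic_index_itv (j + n) t0.
have := H' n; move=> /(congr1 (fun n => n%:R : R)); rewrite -natr1 natrM natrX.
move=> /(canRL (addrK _)) ->.
rewrite exprD; move: nd; rewrite /d mulrBl => nd.
rewrite mulrAC -/a; lra.
Qed.

End dyadic_index.

(** * Uniform discrepancy of the van der Corput sequence *)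

Section van_der_corput.
Context {R : realType}.
Implicit Types (a b : R) (i j k n : nat).

(* The binary van der Corput sequence: the positions [i] with [vdc i < a] have
   density [a], and increase with [a]. *)
Fixpoint vdc_rec n i : R :=
  if n is n'.+1 then ((odd i)%:R + vdc_rec n' i./2) / 2 else 0.

(** Fuel [i] suffices, since [i] has at most [i] binary digits. *)
Definition vdc i := vdc_rec i i.

Lemma vdc_rec0 n : vdc_rec n 0 = 0.
Proof. by elim: n => //= n ->; rewrite add0r mul0r. Qed.

Lemma vdc_rec_fuel n m i : (i <= n)%N -> (i <= m)%N -> vdc_rec n i = vdc_rec m i.
Proof.
elim: m n i => [|m IH] n i.
  by rewrite leqn0 => _ /eqP ->; rewrite vdc_rec0.
case: n => [|n]; first by rewrite leqn0 => /eqP ->; rewrite !vdc_rec0.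
by move=> iltn iltm /=; rewrite (IH n i./2)//; lia.
Qed.

Lemma vdcE i : vdc i = ((odd i)%:R + vdc i./2) / 2.
Proof.
case: i => [|i]; first by rewrite /vdc /= add0r mul0r.
by rewrite {1}/vdc /= (@vdc_rec_fuel _ i.+1./2)//; lia.
Qed.

Lemma vdc_ge0 i : 0 <= vdc i.
Proof.
have [n] := ubnP i; elim: n i => // n IH [|i] ltin; first by rewrite /vdc.
rewrite vdcE divr_ge0// addr_ge0// IH//; lia.
Qed.

Lemma vdc_lt1 i : vdc i < 1.
Proof.
have [n] := ubnP i; elim: n i => // n IH [|i] ltin; first by rewrite /vdc /= ltr01.
have H : vdc i.+1./2 < 1 by apply: IH; lia.
by rewrite vdcE; move: (vdc _) H => v; case: (odd _) => /=; lra.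
Qed.

Definition rank a j : nat := (\sum_(i < j) (vdc i < a)%R)%N.

Lemma rankS a j : rank a j.+1 = (rank a j + (vdc j < a)%R)%N.
Proof. by rewrite /rank big_ord_recr. Qed.

Lemma rank_le a j : (rank a j <= j)%N.
Proof.
elim: j => [|j IH]; first by rewrite /rank big_ord0.
by rewrite rankS; case: (_ < _); lia.
Qed.

Lemma rank_le0 a j : a <= 0 -> rank a j = 0%N.
Proof.
move=> a0; rewrite /rank big1// => i _; apply/eqP; rewrite eqb0 -leNgt.
exact: le_trans (vdc_ge0 _).
Qed.

Lemma rank_ge1 a j : 1 <= a -> rank a j = j.
Proof.
move=> a1; rewrite /rank (eq_bigr (fun=> 1%N)) ?sum1_card ?card_ord// => i _.
by rewrite (lt_le_trans (vdc_lt1 _)).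
Qed.

(** Self-similarity: [vdc] sends 2i to half of [vdc i], and 2i + 1 to half of 1 + [vdc i]. *)
Lemma rank_double a j : rank a j.*2 = (rank (2 * a) j + rank (2 * a - 1) j)%N.
Proof.
elim: j => [|j IH]; first by rewrite /rank !big_ord0.
rewrite doubleS !rankS IH.
have -> : (vdc j.*2 < a) = (vdc j < 2 * a).
  by rewrite vdcE odd_double doubleK /= add0r ltr_pdivrMr// mulrC.
have -> : (vdc j.*2.+1 < a) = (vdc j < 2 * a - 1).
  by rewrite vdcE /= odd_double /= uphalf_double ltr_pdivrMr// ltrBrDl mulrC.
lia.
Qed.

(** Each halving of [j] replaces [a] by 2a or 2a - 1, the other threshold being trivial, and costs
    at most 1 for an unpaired last position. After [k] halvings only the crude bound by the
    remaining length is left. As [k] is free, the error is o(j), uniformly in [a]. *)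
Lemma rank_discrepancy k a j : 0 <= a <= 1 ->
  `|(rank a j)%:R - a * j%:R| <= k%:R + j%:R / 2 ^+ k.
Proof.
elim: k a j => [|k IH] a j /andP[a0 a1].
  rewrite add0r divr1; have := rank_le a j; rewrite -(ler_nat R).
  have : 0 <= (rank a j)%:R :> R by [].
  have : 0 <= a * j%:R by rewrite mulr_ge0.
  have : a * j%:R <= j%:R by rewrite ler_piMl.
  by rewrite ler_norml; lra.
have E : `|(rank a j./2.*2)%:R - a * j./2.*2%:R| <= k%:R + j./2%:R / 2 ^+ k.
  rewrite rank_double -mul2n natrM; have [ha|ha] := leP (2 * a) 1.
    rewrite [rank (2 * a - 1) _]rank_le0 ?addn0; last by lra.
    by rewrite mulrCA mulrA; apply: IH; lra.
  rewrite [rank (2 * a) _]rank_ge1; last by lra.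
  have -> : (j./2 + rank (2 * a - 1) j./2)%:R - a * (2 * j./2%:R) =
    (rank (2 * a - 1) j./2)%:R - (2 * a - 1) * j./2%:R :> R by rewrite natrD; ring.
  by apply: IH; lra.
have H1 : j./2%:R / 2 ^+ k <= j%:R / 2 ^+ k.+1 :> R.
  rewrite exprS invfM mulrA ler_pM2r ?invr_gt0 ?exprn_gt0// ler_pdivlMr//.
  by rewrite -natrM ler_nat; lia.
rewrite -[j in rank a j]odd_double_half -[j in a * j%:R]odd_double_half.
rewrite natrD; case: (odd j) => /=; last by rewrite add0r; lra.
rewrite add1n rankS natrD -[k.+1%:R]natr1; move: E; rewrite !ler_norml.
by case: (vdc _ < a) => /=; lra.
Qed.

End van_der_corput.

(** * The sets [K_a], parametrized by digit insertion *)

Section digit_insertion.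
Context {R : realType}.
Implicit Types (a th t : R) (j k : nat).

(* Generation [j] index of the point obtained from [t] by inserting its binary
   digits at the free positions [i], those with [vdc i < a], and 0 elsewhere. *)
Fixpoint insert_index a t j : nat :=
  if j is j'.+1 then
    ((insert_index a t j').*2 +
     ((vdc j' < a)%R && odd (dyadic_index (rank a j').+1 t)))%N
  else 0%N.

(** This bounds the mass of an interval of generation [j]: the parameters sent into it share their
    first [rank a j] digits. *)
Lemma insert_index_inj a t t' j : unit_itv t -> unit_itv t' ->
  insert_index a t j = insert_index a t' j ->
  dyadic_index (rank a j) t = dyadic_index (rank a j) t'.
Proof.
move=> It It'; have /unit_itvP/andP[t0 _] := It; have /unit_itvP/andP[t'0 _] := It'.
elim: j => [_|j IH /= E].
  have : (dyadic_index (rank a 0) t < 2 ^ (rank a 0))%N by exact: dyadic_index_lt.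
  have : (dyadic_index (rank a 0) t' < 2 ^ (rank a 0))%N by exact: dyadic_index_lt.
  by rewrite /rank big_ord0 expn0; lia.
have {}IH : dyadic_index (rank a j) t = dyadic_index (rank a j) t' by apply: IH; lia.
rewrite rankS; case: (vdc j < a) E => /= E; last by rewrite addn0.
rewrite addn1 -[LHS]odd_double_half -[RHS]odd_double_half !dyadic_index_half// IH.
by congr ((_ : bool) + _)%N; lia.
Qed.

(** The intervals of generations [i] and [j] are nested; their ends are compared in units of
    2^-j. *)
Lemma insert_index_mono a t i j : (i <= j)%N ->
  (insert_index a t i * 2 ^ (j - i) <= insert_index a t j)%N /\
  ((insert_index a t j).+1 <= (insert_index a t i).+1 * 2 ^ (j - i))%N.
Proof.
elim: j => [|j IH]; first by rewrite leqn0 => /eqP ->; rewrite subnn !muln1.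
rewrite leq_eqVlt => /predU1P[->|]; first by rewrite subnn !muln1.
rewrite ltnS => ij; have [H1 H2] := IH ij; rewrite subSn// expnS /=.
by case: (_ && _) => /=; lia.
Qed.

(** Either some later position is fixed and carries 0, or all later positions are free and copy
    consecutive digits of [t], among which [dyadic_index_ones] finds a 0. *)
Lemma insert_index_zero a t j : unit_itv t ->
  exists2 i, (j <= i)%N & (insert_index a t i.+1 = (insert_index a t i).*2)%N.
Proof.
move=> /unit_itvP/andP[t0 _]; apply: contrapT => H.
have H' i : (j <= i)%N -> (vdc i < a) && odd (dyadic_index (rank a i).+1 t).
  move=> ji; apply/negPn/negP => /negbTE E; apply: H; exists i => //=.
  by rewrite E addn0.
have [r jr] := dyadic_index_ones (rank a j) t0.
have rankD n : rank a (j + n) = (rank a j + n)%N.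
  elim: n => [|n IH]; first by rewrite !addn0.
  have /andP[+ _] := H' (j + n)%N (leq_addr _ _).
  by rewrite !addnS rankS IH => ->; rewrite addn1.
have /andP[_] := H' (j + (r - rank a j))%N (leq_addr _ _).
by rewrite rankD subnKC// => ->.
Qed.

(** The point is the supremum of the left ends of the nested intervals. Recurring zero digits keep
    it strictly below every right end, as half-open intervals require. *)
Lemma insert_point a t : unit_itv t ->
  exists x : R, unit_itv x /\ forall j, dyadic_index j x = insert_index a t j.
Proof.
move=> It; pose c := insert_index a t.
pose lo j : R := (c j)%:R / 2 ^+ j; pose hi j : R := (c j).+1%:R / 2 ^+ j.
have p2 j : 0 < 2 ^+ j :> R by rewrite exprn_gt0.
have lo_le i j : (i <= j)%N -> lo i <= lo j.
  move=> ij; rewrite /lo ler_pdivlMr// mulrAC ler_pdivrMr// -!natrX -!natrM ler_nat.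
  rewrite -[X in (_ * 2 ^ X <= _)%N](subnK ij) expnD mulnA leq_mul2r.
  by apply/orP; right; have [] := insert_index_mono a t ij.
have hi_ge i j : (i <= j)%N -> hi j <= hi i.
  move=> ij; rewrite /hi ler_pdivlMr// mulrAC ler_pdivrMr// -!natrX -!natrM ler_nat.
  rewrite -[X in (_ <= _ * 2 ^ X)%N](subnK ij) expnD mulnA leq_mul2r.
  by apply/orP; right; have [] := insert_index_mono a t ij.
have lo_hi j : lo j < hi j by rewrite /lo /hi ltr_pM2r ?invr_gt0// ltr_nat.
have lohi i j : lo i <= hi j.
  have [ij|/ltnW ji] := leqP i j.
    by rewrite (le_trans (lo_le _ _ ij))// ltW.
  by rewrite (le_trans (ltW (lo_hi i)))// hi_ge.
have hs : has_sup (range lo).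
  by split; [exists (lo 0%N), 0%N|exists (hi 0%N) => _ [i _ <-]; exact: lohi].
pose x := sup (range lo).
have lox j : lo j <= x by apply: sup_upper_bound => //; exists j.
have xhi' j : x <= hi j.
  by apply: ge_sup => [|_ [i _ <-]]; [exists (lo 0%N), 0%N|exact: lohi].
have xhi j : x < hi j.
  have [i ji ci] := insert_index_zero a j It.
  apply: le_lt_trans (xhi' i.+1) (lt_le_trans _ (hi_ge _ _ ji)).
  rewrite /hi /c ci exprS invfM mulrA ltr_pM2r ?invr_gt0// ltr_pdivrMr//.
  by rewrite -natrM ltr_nat; lia.
have x0 : 0 <= x by apply: le_trans (lox 0%N); rewrite /lo mulr_ge0// invr_ge0 ltW.
exists x; split.
  by apply/unit_itvP; rewrite x0 (lt_le_trans (xhi 0%N))// /hi expr0 divr1.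
move=> j; apply/(dyadic_indexP j _ x0); rewrite /dyadic_itv/= in_itv/=.
by apply/andP; split; [exact: lox|exact: xhi].
Qed.

(* Density, at generation [j], of the uniform measure on the points whose binary
   digits vanish at every position [i] with [th <= vdc i]. *)
Fixpoint zero_density th j k : R :=
  if j is j'.+1 then
    zero_density th j' k./2 *
    (if vdc j' < th then 1 else if odd k then 0 else 2)
  else 1.

Lemma zero_density_split th j k :
  zero_density th j.+1 k.*2 + zero_density th j.+1 k.*2.+1 =
  2 * zero_density th j k.
Proof.
rewrite /= odd_double /= doubleK uphalf_double.
by case: (vdc j < th) => /=; ring.
Qed.

Lemma zero_density_ge0 th j k : 0 <= zero_density th j k.
Proof.
elim: j k => //= j IH k; apply: mulr_ge0 => //.
by case: ifP => // _; case: ifP.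
Qed.

(** Positions free for [a] are free for [th], so the point has digit 0 at each position fixed for
    [th], and each of these doubles the density. *)
Lemma zero_density_insert a th t j : a <= th ->
  zero_density th j (insert_index a t j) = 2 ^+ (j - rank th j).
Proof.
move=> ath; elim: j => [|j IH] //=.
have -> : ((insert_index a t j).*2 + ((vdc j < a)%R &&
  odd (dyadic_index (rank a j).+1 t)))./2 = insert_index a t j.
  by case: (_ && _); lia.
rewrite IH rankS; have [jth|thj] := ltP (vdc j) th.
  by rewrite mulr1 addn1 subSS.
rewrite ltNge (le_trans ath thj) /= addn0 odd_double addn0 subSn ?exprSr//.
exact: rank_le.
Qed.

Lemma zero_density_ge1 th j k : 1 <= th -> zero_density th j k = 1.
Proof.
by move=> th1; elim: j k => //= j IH k; rewrite IH (lt_le_trans (vdc_lt1 _))// mulr1.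
Qed.

End digit_insertion.

(** * Mass distribution *)

Section scales.
Context {R : realType}.
Implicit Types (d e s z K : R) (j n : nat).

Lemma geometric_small z K e : 0 <= z < 1 -> 0 < e ->
  exists N, forall n, (N <= n)%N -> K * z ^+ n < e.
Proof.
move=> /andP[z0 z1] e0.
have z1' : `|z| < 1 by rewrite ger0_norm.
have /cvgrPdist_lt/(_ _ e0)[N _ H] := cvg_geometric K z1'.
exists N => n Nn; have := H n Nn; rewrite /= sub0r normrN.
exact/le_lt_trans/ler_norm.
Qed.

Lemma half_exp_small e : 0 < e -> exists n, 2 ^- n < e.
Proof.
move=> e0; have h : 0 <= (2^-1 : R) < 1 by rewrite invr_ge0 ler0n invf_lt1 ?ltr1n ?ltr0n.
have [N /(_ N (leqnn _))] := geometric_small 1 h e0.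
by rewrite mul1r exprVn => ?; exists N.
Qed.

Lemma dyadic_scale d : 0 < d <= 1 -> exists j, 2 ^- j.+1 < d <= 2 ^- j.
Proof.
move=> /andP[d0 d1]; have ex := half_exp_small d0.
case: (ex_minnP ex) => -[|j] jd jmin.
  by move: jd; rewrite expr0 invr1 ltNge d1.
exists j; rewrite jd /= leNgt; apply/negP => /jmin; by rewrite ltnn.
Qed.

Lemma half_expn_ler i j : (i <= j)%N -> 2 ^- j <= 2 ^- i :> R.
Proof. by move=> ij; rewrite lef_pV2 ?posrE ?exprn_gt0// ler_eXn2l ?ltr1n. Qed.

Lemma powR_half s j : (2 ^- j) `^ s = (2 `^ (- s)) ^+ j.
Proof.
by rewrite -powR_invn// -powRrM -[in RHS]powR_mulrn ?powR_ge0// -powRrM mulrC mulrN mulNr.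
Qed.

Lemma powR_half_lt1 s : 0 < s -> 0 < (2 : R) `^ (- s) < 1.
Proof.
move=> s0; rewrite powR_gt0//= powRN invf_lt1 ?powR_gt0//.
rewrite -[ltLHS](powRr0 2) /powR pnatr_eq0 /= ltr_expR mul0r.
by rewrite mulr_gt0// ln_gt0// ltr1n.
Qed.

End scales.

Section diameter.
Context {R : realType}.
Implicit Types (U : set R) (x y d r : R).
Local Open Scope ereal_scope.

Lemma diam_ge0 U : 0 <= diam U.
Proof. by apply: ereal_sup_ubound; left. Qed.

Lemma le_diam U x y : U x -> U y -> `|x - y|%:E <= diam U.
Proof. by move=> Ux Uy; apply: ereal_sup_ubound; right; exists x => //; exists y. Qed.

Lemma diam_le U d : (0 <= d)%R -> (forall x y, U x -> U y -> (`|x - y| <= d)%R) ->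
  diam U <= d%:E.
Proof.
move=> d0 H; apply: ge_ereal_sup => _ [->|[x Ux [y Uy <-]]]; first by rewrite lee_fin.
by rewrite lee_fin H.
Qed.

Lemma diam_dyadic_itv j k : diam (dyadic_itv j k : set R) <= (2 ^- j)%:E.
Proof.
apply: diam_le; first by rewrite invr_ge0 exprn_ge0.
move=> x y /dyadic_itvP xk /dyadic_itvP yk.
have j0 : (0 < 2 ^+ j :> R)%R by rewrite exprn_gt0.
rewrite -(ler_pM2l j0) mulfV ?gt_eqF// -{1}(ger0_norm (ltW j0)) -normrM mulrBr.
move: (2 ^+ j * x)%R (2 ^+ j * y)%R xk yk => u v.
by rewrite -natr1 ler_norml; lra.
Qed.

Lemma diam_closed_ball x r : (0 < r)%R -> diam (closed_ball x r) = (2 * r)%:E.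
Proof.
move=> r0; rewrite closed_ball_itv//; apply/eqP; rewrite eq_le; apply/andP; split.
  apply: diam_le => [|u v]; first by rewrite mulr_ge0// ltW.
  by rewrite /= !in_itv /= ler_norml; lra.
have -> : (2 * r = `|(x + r) - (x - r)|)%R.
  have -> : (x + r - (x - r) = 2 * r)%R by ring.
  by rewrite ger0_norm// mulr_ge0// ltW.
by apply: le_diam; rewrite /= in_itv /=; apply/andP; split; lra.
Qed.

End diameter.

Section measures_ge0.
Context {R : realType}.
Implicit Types (A : set R) (s : R).
Local Open Scope ereal_scope.

Lemma hausdorff_measure_ge0 s A : 0 <= hausdorff_measure s A.
Proof.
apply: (@le_trans _ _ (hausdorff_premeasure s 1 A)); last first.
  by apply: ereal_sup_ubound; exists 1%R => //=.
apply: le_ereal_inf_tmp => _ [U _ <-]; apply: nneseries_ge0 => *; exact: poweR_ge0.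
Qed.

Lemma packing_premeasure_ge0 s A : 0 <= packing_premeasure s A.
Proof.
  apply: le_ereal_inf_tmp => _ [d _ <-]; apply: ereal_sup_ubound.
  exists set0, (cst 0%R), (cst 0%R); split; last by rewrite esum_set0.
  by split => [?|? ?] [].
Qed.

Lemma packing_measure_ge0 s A : 0 <= packing_measure s A.
Proof.
apply: le_ereal_inf_tmp => _ [F _ <-]; apply: nneseries_ge0 => n _ _.
exact: packing_premeasure_ge0.
Qed.

End measures_ge0.

Lemma adjacent_index (k m : nat) : (k < m.+2)%N -> (m < k.+2)%N ->
  m = k.-1 \/ m = k \/ m = k.+1.
Proof. lia. Qed.

Lemma same_parity b (k k' : nat) : odd k = b -> odd k' = b ->
  (k' < k.+2)%N -> (k < k'.+2)%N -> k = k'.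
Proof. by move=> <-; lia. Qed.

Section mass_distribution.
Context {R : realType}.
Variables (mu : {outer_measure set R -> \bar R}) (s C : R).
Hypotheses (s_gt0 : 0 < s) (C_ge0 : 0 <= C).
Hypothesis mu_unit : mu (~` unit_itv) = 0%E.
Hypothesis mu_dyadic :
  forall j k, (mu (dyadic_itv j k) <= (C * (2 `^ (- s)) ^+ j)%:E)%E.
Local Open Scope ereal_scope.
Implicit Types (A F U : set R).

Let mu_le U V : U `<=` V -> mu U <= mu V.
Proof. exact: le_outer_measure. Qed.

(** Such a set, if it meets the unit interval, is covered there by three consecutive dyadic
    intervals of generation [j]. *)
Lemma mass_le_scale U j : diam U <= (2 ^- j)%:E ->
  mu U <= (3 * C * (2 `^ (- s)) ^+ j)%:E.
Proof.
move=> dU; have a0 : (0 <= (2 `^ (- s)) ^+ j)%R by rewrite exprn_ge0// powR_ge0.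
have [U0|/set0P[x [Ux Ix]]] := eqVneq (U `&` unit_itv) set0.
  apply: (@le_trans _ _ 0); last by rewrite lee_fin !mulr_ge0.
  by rewrite -mu_unit; apply: mu_le; apply/disjoints_subset.
set k := dyadic_index j x.
have /unit_itvP/andP[x0 _] := Ix; have /andP[kx xk] := dyadic_index_itv j x0; rewrite -/k in kx xk.
(* For [k = 0] the predecessor is again 0, which only repeats an interval. *)
apply: (@le_trans _ _ (mu (~` unit_itv `|`
  (dyadic_itv j k.-1 `|` (dyadic_itv j k `|` dyadic_itv j k.+1))))).
  apply: mu_le => y Uy; have [/unit_itvP/andP[y0 _]|] := pselect (unit_itv y); last by left.
  right; have /andP[ky yk] := dyadic_index_itv j y0.
  suff : (dyadic_index j y = k.-1 \/ dyadic_index j y = k \/ dyadic_index j y = k.+1)%N.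
    by case=> [|[]] /(dyadic_indexP _ _ y0) ?; [left|right; left|right; right].
  have /le_trans/(_ dU) := le_diam Ux Uy; rewrite lee_fin.
  have j0 : (0 < 2 ^+ j :> R)%R by rewrite exprn_gt0.
  rewrite -(ler_pM2l j0) mulfV ?gt_eqF// -{1}(ger0_norm (ltW j0)) -normrM mulrBr.
  rewrite ler_norml => /andP[H1 H2].
  have : ((dyadic_index j y)%:R < (k.+2)%:R :> R)%R.
    by apply: le_lt_trans ky _; move: xk; rewrite -[k.+2%:R]natr1 -[k.+1%:R]natr1; lra.
  have : (k%:R < (dyadic_index j y).+2%:R :> R)%R.
    apply: le_lt_trans kx _; move: yk; move: (dyadic_index j y) => m.
    by rewrite -[m.+2%:R]natr1 -[m.+1%:R]natr1; lra.
  by rewrite !ltr_nat; exact: adjacent_index.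
apply: le_trans (outer_measureU2 _ _ _) _; rewrite mu_unit add0e.
apply: le_trans (outer_measureU2 _ _ _) _.
have -> : (3 * C * (2 `^ (- s)) ^+ j)%:E = (C * (2 `^ (- s)) ^+ j)%:E +
  ((C * (2 `^ (- s)) ^+ j)%:E + (C * (2 `^ (- s)) ^+ j)%:E).
  by rewrite -!EFinD; congr EFin; ring.
apply: leeD => //; apply: le_trans (outer_measureU2 _ _ _) _; exact: leeD.
Qed.

Let K := (3 * C * 2 `^ s)%R.

Let K_ge0 : (0 <= K)%R.
Proof. by rewrite !mulr_ge0// powR_ge0. Qed.

Lemma mass_le_diam U : diam U <= 1 -> mu U <= K%:E * diam U `^ s.
Proof.
move=> dU1.
have [d dU] : exists d, diam U = d%:E.
  exists (fine (diam U)); rewrite fineK// ge0_fin_numE ?diam_ge0//.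
  exact: le_lt_trans dU1 (ltry _).
have d0 : (0 <= d)%R by rewrite -lee_fin -dU diam_ge0.
have d1 : (d <= 1)%R by rewrite -lee_fin -dU.
have a1 := powR_half_lt1 s_gt0.
(* A set of diameter 0 satisfies the bound at every scale, so it has mass 0. *)
have [d00|d_neq0] := eqVneq d 0%R.
  apply: (@le_trans _ _ 0); last by rewrite mule_ge0 ?lee_fin// poweR_ge0.
  apply/lee_addgt0Pr => e e0; rewrite add0e.
  have a1' : (0 <= 2 `^ (- s) < 1)%R by case/andP: a1 => /ltW -> ->.
  have [N /(_ N (leqnn _)) HN] := geometric_small (3 * C) a1' e0.
  apply: le_trans (@mass_le_scale _ N _) _; last by rewrite lee_fin ltW.
  by rewrite dU d00 lee_fin invr_ge0 exprn_ge0.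
have dpos : (0 < d <= 1)%R by rewrite lt_def d_neq0 d0.
have [j /andP[jd dj]] := dyadic_scale dpos.
apply: le_trans (@mass_le_scale _ j _) _; first by rewrite dU lee_fin.
rewrite dU poweR_EFin -EFinM lee_fin /K -!mulrA !ler_wpM2l//.
apply: (@le_trans _ _ (2 `^ s * (2 ^- j.+1) `^ s)%R).
  by rewrite powR_half exprS mulrA -powRD ?subrr ?powRr0 ?mul1r// pnatr_eq0 implybT.
rewrite ler_wpM2l ?powR_ge0// ge0_ler_powR// ?nnegrE ?ltW// invr_gt0 exprn_gt0//.
Qed.

(** Mass distribution principle: a cover by sets of diameter at most 1 with small [s]-sum has small
    mass by [mass_le_diam]. Dividing by [K + 1] avoids the case [K = 0]. *)
Lemma mass_hausdorff A : hausdorff_measure s A = 0 -> mu A = 0.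
Proof.
move=> HA; apply/eqP; rewrite eq_le outer_measure_ge0 andbT.
have : hausdorff_premeasure s 1 A <= 0.
  by rewrite -HA; apply: ereal_sup_ubound; exists 1%R => //=.
move=> H; apply/lee_addgt0Pr => e e0; rewrite add0e.
have K1 : (0 < K + 1)%R by rewrite ltr_wpDl.
have : hausdorff_premeasure s 1 A < (e / (K + 1))%:E.
  by apply: le_lt_trans H _; rewrite lte_fin divr_gt0.
move=> /ereal_inf_lt[_ [U [AU dU] <-]] /ltW HU.
apply: le_trans (mu_le AU) _; apply: le_trans (outer_measure_sigma_subadditive _ _) _.
apply: (@le_trans _ _ (\sum_(k <oo) (K%:E * diam (U k) `^ s))).
  by apply: lee_nneseries => [k _ _|k _]; [exact: outer_measure_ge0|exact: mass_le_diam].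
rewrite nneseriesZl; last by move=> *; exact: poweR_ge0.
apply: le_trans (lee_wpmul2l _ HU) _; rewrite ?lee_fin//.
rewrite mulrCA ler_piMr ?(ltW e0)// ler_pdivrMr// mul1r lerDl//.
Qed.

Lemma outer_measure_bigcup_esum (D : set nat) (G : nat -> set R) (v : nat -> \bar R) :
  (forall k, 0 <= v k) -> (forall k, D k -> mu (G k) <= K%:E * v k) ->
  mu (\bigcup_(k in D) G k) <= K%:E * \esum_(k in D) v k.
Proof.
move=> v0 H; rewrite bigcup_mkcond.
apply: le_trans (outer_measure_sigma_subadditive _ _) _.
rewrite esum_mkcond -nneseries_esumT; last by move=> n; case: ifP.
rewrite -nneseriesZl; last by move=> n _; case: ifP.
apply: lee_nneseries => [k _ _|k _]; first exact: outer_measure_ge0.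
by case: ifPn => [/set_mem|_]; [exact: H|rewrite outer_measure0 mule0].
Qed.

(* One point in every dyadic interval that meets [F]: those in the intervals of
   a given parity are far enough apart to be the centers of a packing. *)
Lemma mass_le_packing_delta F delta : (0 < delta)%R ->
  mu F <= (2 * K)%:E * packing_premeasure_delta s delta F.
Proof.
move=> delta0; have [j jd] := half_exp_small delta0.
(* A quarter of the length of the intervals: points of distinct intervals of equal parity are more
   than 2^-j apart, so the balls are disjoint. *)
pose r : R := 2 ^- j.+2; have r0 : (0 < r)%R by rewrite invr_gt0 exprn_gt0.
have rj : (4 * r = 2 ^- j)%R by rewrite /r 2!exprS; field; rewrite expf_neq0.
pose D (b : bool) : set nat := [set k | odd k = b /\ F `&` dyadic_itv j k !=set0].
pose x k : R := get (F `&` dyadic_itv j k).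
have xP b k : D b k -> F (x k) /\ dyadic_itv j k (x k).
  by case=> _ /getPex [].
have pack b : is_packing delta F (D b) x (cst r).
  split=> [k Dk|].
    have [? _] := xP _ _ Dk; split => //=; rewrite r0/= ltW//.
    by apply: le_lt_trans jd; rewrite -rj; lra.
  move=> k k' Dk Dk' [y0]; pose y : R := y0.
  rewrite /= !closed_ball_itv//= !in_itv/= -/y => -[H1 H2].
  have [_ /dyadic_itvP xk] := xP _ _ Dk; have [_ /dyadic_itvP xk'] := xP _ _ Dk'.
  have j0 : (0 < 2 ^+ j :> R)%R by rewrite exprn_gt0.
  have rE : (2 ^+ j * r = 4^-1)%R.
    have -> : r = (4^-1 * 2 ^- j)%R by rewrite -rj; field.
    by rewrite mulrCA mulfV ?mulr1// gt_eqF.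
  have {}H1 : (2 ^+ j * x k - 4^-1 <= 2 ^+ j * y <= 2 ^+ j * x k + 4^-1)%R.
    by rewrite -rE -mulrBr -mulrDr !ler_pM2l.
  have {}H2 : (2 ^+ j * x k' - 4^-1 <= 2 ^+ j * y <= 2 ^+ j * x k' + 4^-1)%R.
    by rewrite -rE -mulrBr -mulrDr !ler_pM2l.
  move: (2 ^+ j * y)%R (2 ^+ j * x k)%R (2 ^+ j * x k')%R H1 H2 xk xk' => u v w.
  rewrite -[k.+1%:R]natr1 -[k'.+1%:R]natr1 => H1 H2 H3 H4.
  have : (k%:R < k'.+2%:R :> R)%R by rewrite -[k'.+2%:R]natr1 -[k'.+1%:R]natr1; lra.
  have : (k'%:R < k.+2%:R :> R)%R by rewrite -[k.+2%:R]natr1 -[k.+1%:R]natr1; lra.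
  rewrite !ltr_nat => kk' k'k; case: Dk => [ok _]; case: Dk' => [ok' _].
  exact: (same_parity ok ok').
have one b : mu (\bigcup_(k in D b) dyadic_itv j k) <=
    K%:E * packing_premeasure_delta s delta F.
  apply: (@le_trans _ _ (K%:E * \esum_(k in D b) diam (closed_ball (x k) r) `^ s)).
    apply: outer_measure_bigcup_esum => [k|k _]; first exact: poweR_ge0.
    apply: le_trans (mu_dyadic _ _) _.
    rewrite diam_closed_ball// poweR_EFin -EFinM lee_fin /K.
    have -> : (2 * r = 2 ^- j.+1)%R by rewrite /r 2!exprS; field; rewrite expf_neq0.
    rewrite powR_half exprS mulrA -[(3 * C * _ * _)%R]mulrA.
    rewrite -powRD ?subrr ?powRr0 ?mulr1 ?pnatr_eq0 ?implybT//.
    by rewrite -mulrA ler_peMl ?mulr_ge0 ?exprn_ge0 ?powR_ge0// ler1n.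
  apply: lee_wpmul2l; rewrite ?lee_fin//.
  apply: ereal_sup_ubound; exists (D b), x, (cst r); split; first exact: pack.
  by [].
apply: (@le_trans _ _ (mu (~` unit_itv `|` (\bigcup_(k in D true) dyadic_itv j k `|`
   \bigcup_(k in D false) dyadic_itv j k)))).
  apply: mu_le => y Fy; have [/unit_itvP/andP[y0 _]|] := pselect (unit_itv y); last by left.
  have dy : dyadic_itv j (dyadic_index j y) y by apply/dyadic_indexP.
  right; case E : (odd (dyadic_index j y)); [left|right];
    by exists (dyadic_index j y) => //; split => //; exists y.
apply: le_trans (outer_measureU2 _ _ _) _; rewrite mu_unit add0e.
apply: le_trans (outer_measureU2 _ _ _) _; rewrite mulr_natl mulr2n EFinD.
by rewrite ge0_muleDl ?lee_fin//; apply: leeD.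
Qed.

(** The constant of [mass_le_packing_delta] does not depend on [delta], so the bound passes to the
    packing premeasure, and by countable subadditivity to the packing measure. *)
Lemma mass_packing A : packing_measure s A = 0 -> mu A = 0.
Proof.
move=> HA; apply/eqP; rewrite eq_le outer_measure_ge0 andbT.
apply/lee_addgt0Pr => e e0; rewrite add0e.
have K1 : (0 < 2 * K + 1)%R by rewrite ltr_wpDl// mulr_ge0.
have : packing_measure s A < (e / (2 * K + 1))%:E by rewrite HA lte_fin divr_gt0.
move=> /ereal_inf_lt[_ [F AF <-]] /ltW HF.
have P0 k : 0 <= packing_premeasure s (F k) by exact: packing_premeasure_ge0.
apply: le_trans (mu_le AF) _; apply: le_trans (outer_measure_sigma_subadditive _ _) _.
apply: (@le_trans _ _ (\sum_(k <oo) ((2 * K + 1)%:E * packing_premeasure s (F k)))).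
  apply: lee_nneseries => [k _ _|k _]; first exact: outer_measure_ge0.
  rewrite -lee_pdivrMl//; apply: le_ereal_inf_tmp => _ [d d0 <-].
  rewrite lee_pdivrMl//; apply: le_trans (mass_le_packing_delta _ d0) _.
  apply: lee_wpmul2r; last by rewrite lee_fin lerDl.
  apply: le_trans (P0 k) _; apply: ereal_inf_lbound; exists d => //.
rewrite nneseriesZl; last by move=> *; exact: P0.
apply: le_trans (lee_wpmul2l _ HF) _; first by rewrite lee_fin ltW.
by rewrite lee_fin mulrC divfK ?gt_eqF.
Qed.

End mass_distribution.

(** * Coverings and packings by selected dyadic intervals *)

Section dyadic_enumeration.
Implicit Types (n j k : nat).

(* Heap numbering: [2 ^ j + k] stands for the interval of index [k] in generation
   [j]. *)
Definition node_gen n := trunc_log 2 n.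
Definition node_pos n := (n - 2 ^ node_gen n)%N.

Lemma node_genE j k : (k < 2 ^ j)%N -> node_gen (2 ^ j + k) = j.
Proof.
by move=> kj; apply: trunc_log_eq => //; rewrite leq_addr expnS; lia.
Qed.

Lemma node_posE j k : (k < 2 ^ j)%N -> node_pos (2 ^ j + k) = k.
Proof. by move=> kj; rewrite /node_pos node_genE// addKn. Qed.

Lemma sum_nodes (V : nmodType) (w : nat -> V) N :
  \sum_(1 <= n < 2 ^ N) w n = \sum_(j < N) \sum_(k < 2 ^ j) w (2 ^ j + k)%N.
Proof.
elim: N => [|N IH]; first by rewrite expn0 big_geq// big_ord0.
rewrite big_ord_recr /= -IH (@big_cat_nat _ _ _ (2 ^ N))/= ?expn_gt0//; last first.
  by rewrite leq_exp2l.
congr +%R; rewrite -[in LHS](add0n (2 ^ N)%N) big_addn big_mkord.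
have -> : (2 ^ N.+1 - 2 ^ N = 2 ^ N)%N by rewrite expnS; lia.
by apply: eq_bigr => i _; rewrite addnC.
Qed.

End dyadic_enumeration.

Lemma geometric_tail (R : comPzRingType) (q : R) J n :
  (1 - q) * \sum_(j < n | (J <= j)%N) q ^+ j = q ^+ J - q ^+ maxn J n.
Proof.
elim: n => [|n IH]; first by rewrite big_ord0 mulr0 maxn0 subrr.
rewrite big_mkcond big_ord_recr /= -big_mkcond mulrDr IH.
case: leqP => [Jn|nJ].
  by rewrite (maxn_idPr (leqW Jn)) exprS; ring.
by rewrite (maxn_idPl nJ) mulr0 addr0.
Qed.

Section covering.
Context {R : realType}.
(* [S j k] selects the dyadic interval of generation [j] and index [k]. *)
Variables (S : nat -> nat -> bool) (M b s : R).
Hypotheses (s_gt0 : 0 < s) (M_ge0 : 0 <= M) (b_ge0 : 0 <= b).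
Hypothesis ratio_lt1 : 2 `^ (- s) * b < 1.
Hypothesis count_le : forall j, \sum_(k < 2 ^ j) (S j k)%:R <= M * b ^+ j.
Implicit Types (A : set R) (J j k n : nat).

Let a := (2 : R) `^ (- s).

Let a_ge0 : 0 <= a. Proof. exact: powR_ge0. Qed.

(** Heap numbers start at 1; the number 0 would decode to the root a second time. *)
Definition selected J n : bool :=
  [&& (0 < n)%N, (J <= node_gen n)%N & S (node_gen n) (node_pos n)].

Definition weight J n : R := if selected J n then a ^+ node_gen n else 0.

Lemma weight_ge0 J n : 0 <= weight J n.
Proof. by rewrite /weight; case: ifP => // _; rewrite exprn_ge0. Qed.

(** Generation [j] contributes at most [M * b ^+ j] intervals, each with [s]-th power of length
    [a ^+ j]: a geometric tail of ratio [a * b]. *)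
Lemma weight_sum J : (\sum_(n <oo) (weight J n)%:E <=
  (M / (1 - a * b) * (a * b) ^+ J)%:E)%E.
Proof.
have ab0 : 0 <= a * b by rewrite mulr_ge0.
have ab1 : 0 < 1 - a * b by rewrite subr_gt0.
apply: lime_le; first by apply: is_cvg_nneseries => n _ _; rewrite lee_fin weight_ge0.
apply: nearW => n; rewrite sumEFin lee_fin.
have nn : (n <= 2 ^ n)%N by rewrite ltnW// ltn_expl.
apply: (@le_trans _ _ (\sum_(0 <= i < 2 ^ n) weight J i)).
  rewrite [leRHS](@big_cat_nat _ _ _ n)//= lerDl sumr_ge0// => i _.
  exact: weight_ge0.
rewrite big_ltn ?expn_gt0// /weight /selected /= add0r sum_nodes.
have -> : \sum_(j < n) \sum_(k < 2 ^ j) (if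
    [&& (0 < 2 ^ j + k)%N, (J <= node_gen (2 ^ j + k))%N &
     S (node_gen (2 ^ j + k)) (node_pos (2 ^ j + k))]
     then a ^+ node_gen (2 ^ j + k) else 0) =
  \sum_(j < n | (J <= j)%N) a ^+ j * \sum_(k < 2 ^ j) (S j k)%:R.
  rewrite [RHS]big_mkcond; apply: eq_bigr => j _; case: ifPn => Jj.
    rewrite mulr_sumr; apply: eq_bigr => k _.
    rewrite node_genE// node_posE// addn_gt0 expn_gt0 Jj /=.
    by case: (S j k); rewrite ?mulr1 ?mulr0.
  by rewrite big1// => k _; rewrite node_genE// (negbTE Jj) /= andbF.
apply: (@le_trans _ _ (\sum_(j < n | (J <= j)%N) M * (a * b) ^+ j)).
  apply: ler_sum => j _; rewrite exprMn mulrCA ler_wpM2l ?exprn_ge0//.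
rewrite -mulr_sumr -mulrA ler_wpM2l// [leRHS]mulrC ler_pdivlMr// mulrC geometric_tail.
by rewrite lerBlDr lerDl exprn_ge0.
Qed.

Lemma weight_small e : (0 < e)%R ->
  exists J, (\sum_(n <oo) (weight J n)%:E <= e%:E)%E.
Proof.
move=> e0; have ab : 0 <= a * b < 1 by rewrite ratio_lt1 mulr_ge0.
have [J /(_ J (leqnn _)) H] := geometric_small (M / (1 - a * b)) ab e0.
by exists J; apply: le_trans (weight_sum J) _; rewrite lee_fin ltW.
Qed.

Lemma weight_mono I J n : (I <= J)%N -> weight J n <= weight I n.
Proof.
move=> IJ; rewrite /weight /selected; case: (0 < n)%N => //=.
case: (leqP J (node_gen n)) => [/(leq_trans IJ) -> //|_] /=.
by case: ifP; rewrite ?exprn_ge0.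
Qed.

Lemma weight_le e J : (\sum_(n <oo) (weight J n)%:E <= e%:E)%E ->
  forall I, (J <= I)%N -> (\sum_(n <oo) (weight I n)%:E <= e%:E)%E.
Proof.
move=> H I JI; apply: le_trans H; apply: lee_nneseries => [n _ _|n _].
  by rewrite lee_fin weight_ge0.
by rewrite lee_fin weight_mono.
Qed.

(** Borel-Cantelli argument: for every [J] the selected intervals of generation at least [J] cover
    [A], and their total weight tends to 0. *)
Lemma hausdorff_limsup_set A :
  (forall x, A x -> unit_itv x /\
     forall J, exists2 j, (J <= j)%N & S j (dyadic_index j x)) ->
  hausdorff_measure s A = 0%E.
Proof.
move=> HA; apply/eqP; rewrite eq_le hausdorff_measure_ge0 andbT.
apply: ge_ereal_sup => _ [delta /= delta0 <-].
apply/lee_addgt0Pr => e e0; rewrite add0e.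
have [J1 HJ1] := weight_small e0; have [J2 HJ2] := half_exp_small delta0.
have {HJ1} HJ1 := weight_le HJ1 (leq_maxl J1 J2).
set J := maxn J1 J2 in HJ1.
pose U n : set R := if selected J n then dyadic_itv (node_gen n) (node_pos n) else set0.
have diam0 : diam (set0 : set R) = 0%E.
  by apply/eqP; rewrite eq_le diam_ge0 andbT; apply: diam_le.
have dU n : (diam (U n) <= (if selected J n then 2 ^- node_gen n else 0)%:E)%E.
  by rewrite /U; case: ifP => _; [exact: diam_dyadic_itv|rewrite diam0].
apply: le_trans (ereal_inf_lbound _) _; first exists U => //.
  split=> [x /HA[Ix /(_ J)[j Jj Sj]]|n].
    have kj := dyadic_index_lt j Ix.
    exists (2 ^ j + dyadic_index j x)%N => //; rewrite /U /selected.
    rewrite node_genE// node_posE// Jj Sj addn_gt0 expn_gt0 /=.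
    by apply/dyadic_indexP => //; case/unit_itvP/andP: Ix.
  apply: le_trans (dU n) _; rewrite lee_fin; case: ifP => [/and3P[_ Jn _]|_]; last exact: ltW.
  apply: le_trans (ltW HJ2); apply: half_expn_ler; apply: leq_trans Jn.
  exact: leq_maxr.
apply: le_trans HJ1; apply: lee_nneseries => [n _ _|n _]; first exact: poweR_ge0.
apply: le_trans (gt0_ler_poweR (ltW s_gt0) _ _ (dU n)) _.
- by rewrite in_itv /= diam_ge0 leey.
- by rewrite in_itv /= leey andbT lee_fin; case: ifP => // _; rewrite invr_ge0 exprn_ge0.
- rewrite /weight; case: ifP => _; rewrite poweR_EFin; last by rewrite powR0// gt_eqF.
  by rewrite powR_half.
Qed.

(* A ball of a packing contains a dyadic interval of comparable length around
   its center, and disjoint balls give distinct intervals. *)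
Lemma packing_liminf_set A J0 :
  (forall x, A x -> unit_itv x /\ forall j, (J0 <= j)%N -> S j (dyadic_index j x)) ->
  packing_premeasure s A = 0%E.
Proof.
move=> HA; apply/eqP; rewrite eq_le packing_premeasure_ge0 andbT.
apply/lee_addgt0Pr => e e0; rewrite add0e.
have c0 : 0 < 4 `^ s :> R by rewrite powR_gt0.
have [J1 HJ1] := weight_small (divr_gt0 e0 c0).
have {HJ1} HJ1 := weight_le HJ1 (leq_maxr J0 J1).
set J := maxn J0 J1 in HJ1.
apply: le_trans (ereal_inf_lbound _) _.
  by exists (2 ^- J) => //; rewrite /= invr_gt0 exprn_gt0.
apply: ge_ereal_sup => _ [D [x [r [[Dxr triv] ->]]]].
have /choice[g gP] : forall i, exists j, D i -> 2 ^- j.+1 < r i <= 2 ^- j.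
  move=> i; have [Di|] := pselect (D i); last by exists 0%N.
  have [_ /andP[r0 rJ]] := Dxr _ Di.
  have [|j jP] := @dyadic_scale R (r i); last by exists j.
  rewrite r0 (le_trans rJ)// invf_le1 ?exprn_gt0// exprn_ege1// ler1n//.
pose node i := (2 ^ (g i).+1 + dyadic_index (g i).+1 (x i))%N.
have Ix i : D i -> unit_itv (x i) by case/Dxr => /HA[].
have nodeP i : D i -> (node_gen (node i) = (g i).+1)%N /\
    node_pos (node i) = dyadic_index (g i).+1 (x i).
  move=> Di; have kj := dyadic_index_lt (g i).+1 (Ix _ Di).
  by rewrite node_genE// node_posE.
have Jg i : D i -> (J <= (g i).+1)%N.
  move=> Di; have [_ /andP[_ rJ]] := Dxr _ Di; have /andP[H _] := gP _ Di.
  have := lt_le_trans H rJ; rewrite ltf_pV2 ?posrE ?exprn_gt0// ltr_eXn2l ?ltr1n//.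
  exact: ltnW.
have node_inj : set_inj D node.
  move=> i i' /set_mem Di /set_mem Di' E.
  have [Gi Pi] := nodeP _ Di; have [Gi' Pi'] := nodeP _ Di'.
  apply: (triv _ _ Di Di'); exists (x i).
  have ri : 0 < r i by have [_ /andP[]] := Dxr _ Di.
  have ri' : 0 < r i' by have [_ /andP[]] := Dxr _ Di'.
  split; first by rewrite /= closed_ball_itv//= in_itv/=; apply/andP; split; lra.
  have /unit_itvP/andP[x0 _] := Ix _ Di; have /unit_itvP/andP[x0' _] := Ix _ Di'.
  have xi : dyadic_itv (g i').+1 (dyadic_index (g i').+1 (x i')) (x i).
    by apply/dyadic_indexP => //; rewrite -Pi' -Gi' -E Gi Pi.
  have xi' : dyadic_itv (g i').+1 (dyadic_index (g i').+1 (x i')) (x i').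
    by apply/dyadic_indexP.
  have := le_trans (le_diam xi xi') (diam_dyadic_itv _ _); rewrite lee_fin => dx.
  have /andP[gr _] := gP _ Di'; have := le_lt_trans dx gr.
  by rewrite closed_ball_itv//= in_itv/= ltr_norml => /andP[? ?]; apply/andP; split; lra.
apply: (@le_trans _ _ (\esum_(i in D) ((4 `^ s)%:E * (weight J (node i))%:E))%E).
  apply: le_esum => i Di; have [Gi Pi] := nodeP _ Di.
  have [Axi /andP[ri _]] := Dxr _ Di; have [_ Si] := HA _ Axi.
  rewrite /weight /selected Gi Pi Jg// addn_gt0 expn_gt0 /= Si; last first.
    exact: leq_trans (leq_maxl _ _) (Jg _ Di).
  rewrite diam_closed_ball// poweR_EFin -EFinM lee_fin -powR_half -powRM ?invr_ge0 ?exprn_ge0//.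
  have /andP[_ rg] := gP _ Di.
  rewrite ge0_ler_powR ?nnegrE ?mulr_ge0 ?invr_ge0 ?exprn_ge0 ?(ltW s_gt0) ?(ltW ri)//.
  by rewrite exprS invfM; lra.
rewrite -(esum_image D node (fun n => (4 `^ s)%:E * (weight J n)%:E)%E)//.
have w0 n : (0 <= (4 `^ s)%:E * (weight J n)%:E)%E.
  by rewrite -EFinM lee_fin mulr_ge0 ?powR_ge0 ?weight_ge0.
rewrite esum_mkcond.
apply: (@le_trans _ _ (\esum_(n in [set: nat]) ((4 `^ s)%:E * (weight J n)%:E))%E).
  by apply: le_esum => n _; case: ifP.
rewrite -nneseries_esumT// nneseriesZl; last by move=> n _; rewrite lee_fin weight_ge0.
apply: le_trans (lee_wpmul2l _ HJ1) _; first by rewrite lee_fin powR_ge0.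
by rewrite -EFinM lee_fin mulrC divfK// gt_eqF.
Qed.

(** The packing measure allows countable decompositions: the points are split according to the
    generation from which all their intervals are selected. *)
Lemma packing_liminf A :
  (forall x, A x -> unit_itv x /\
     exists J, forall j, (J <= j)%N -> S j (dyadic_index j x)) ->
  packing_measure s A = 0%E.
Proof.
move=> HA; apply/eqP; rewrite eq_le packing_measure_ge0 andbT.
pose F J : set R := [set x | unit_itv x /\ forall j, (J <= j)%N -> S j (dyadic_index j x)].
apply: le_trans (ereal_inf_lbound _) _; first exists F.
- by move=> x /HA[Ix [J HJ]]; exists J.
- by [].
- by rewrite eseries0// => n _ _; apply: (@packing_liminf_set _ n).
Qed.

End covering.

(** * Dyadic means and square integrable functions *)

Section lebesgue01_dyadic.
Context {R : realType}.
Local Notation mu := (lebesgue01 R).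
Local Notation mR := (measurableTypeR R).
Implicit Types (f g : mR -> R) (i j k : nat) (x : R).

Lemma measurable_dyadic_itv j k : measurable (dyadic_itv j k : set mR).
Proof. exact: measurable_itv. Qed.
Hint Resolve measurable_dyadic_itv : core.

Lemma lebesgue01E (A : set mR) :
  mu A = lebesgue_measure (A `&` unit_itv).
Proof. by []. Qed.

Lemma lebesgue_measure_unit : lebesgue_measure (unit_itv : set mR) = 1%E.
Proof.
by have := lebesgue_measure_itv `[0%R : R, 1[; rewrite /= lte_fin ltr01 oppr0 adde0.
Qed.

Lemma lebesgue_measure_dyadic j k :
  lebesgue_measure (dyadic_itv j k : set mR) = (2 ^- j)%:E.
Proof.
have := lebesgue_measure_itv `[k%:R / 2 ^+ j : R, k.+1%:R / 2 ^+ j[; rewrite /=.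
rewrite /dyadic_itv lte_fin ltr_pM2r ?invr_gt0 ?exprn_gt0// ltr_nat ltnSn => ->.
by rewrite -EFinD -mulrBl -natr1 addrAC subrr add0r mul1r.
Qed.

Lemma lebesgue01_setT : mu setT = 1%E.
Proof. by rewrite lebesgue01E setTI lebesgue_measure_unit. Qed.

Lemma lebesgue01_dyadic j k : (k < 2 ^ j)%N -> mu (dyadic_itv j k) = (2 ^- j)%:E.
Proof.
move=> kj; rewrite lebesgue01E setIidl ?lebesgue_measure_dyadic//.
by move=> x /(dyadic_itv_unit kj).
Qed.

Lemma integrableW f (A : set mR) : measurable A ->
  mu.-integrable setT (EFin \o f) -> mu.-integrable A (EFin \o f).
Proof. by move=> mA; apply: integrableS. Qed.

Definition sq_integrable f := f \in Lfun mu 2%:E.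

Lemma sq_integrable_meas f : sq_integrable f -> measurable_fun setT f.
Proof. by rewrite /sq_integrable inE => /andP[/[!inE]]. Qed.

Lemma sq_integrable_sqr f : sq_integrable f ->
  mu.-integrable setT (EFin \o (fun x => f x ^+ 2)).
Proof. exact: Lfun2_integrable_sqr. Qed.

Lemma sq_integrable_int f : sq_integrable f -> mu.-integrable setT (EFin \o f).
Proof.
move=> f2; apply/Lfun1_integrable; apply: Lfun_subset12 f2.
by rewrite lebesgue01_setT.
Qed.

Lemma sq_integrableP f : measurable_fun setT f ->
  (\int[mu]_x (f x ^+ 2)%:E < +oo)%E -> sq_integrable f.
Proof.
move=> mf ff; rewrite /sq_integrable inE; apply/andP; split; rewrite inE//=.
rewrite /finite_norm unlock /Lnorm poweR_lty//.
apply: le_lt_trans ff; rewrite le_eqVlt; apply/orP; left; apply/eqP.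
by apply: eq_integral => x _; rewrite /= powR_mulrn// real_normK ?num_real.
Qed.

Lemma sq_integrableB f g : sq_integrable f -> sq_integrable g ->
  sq_integrable (f \- g).
Proof.
move=> f2 g2; have : f - g \in Lfun mu 2%:E by apply: rpredB; rewrite ?lee1n.
by [].
Qed.

Lemma sq_integrableD f g : sq_integrable f -> sq_integrable g ->
  sq_integrable (f \+ g).
Proof.
move=> f2 g2; have : f + g \in Lfun mu 2%:E by apply: rpredD; rewrite ?lee1n.
by [].
Qed.

Lemma Rintegral_indic_mul f (A : set mR) :
  \int[mu]_x (f x * \1_A x) = \int[mu]_(x in A) f x.
Proof.
rewrite [RHS]Rintegral_mkcond; apply: eq_Rintegral => x _.
by rewrite indicE patchE; case: ifP => _; rewrite ?mulr1 ?mulr0.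
Qed.

Lemma integrable_indic_mul f (A : set mR) : measurable A ->
  mu.-integrable setT (EFin \o f) ->
  mu.-integrable setT (EFin \o (fun x => f x * \1_A x)).
Proof.
move=> mA /(integrableW mA); rewrite integrable_mkcond//.
apply: eq_integrable => // x _ /=.
by rewrite patchE indicE; case: ifP => _; rewrite ?mulr1 ?mulr0.
Qed.

Definition dyadic_mean f j k : R := 2 ^+ j * \int[mu]_(x in dyadic_itv j k) f x.

Lemma Rintegral_dyadic_split f j k : mu.-integrable setT (EFin \o f) ->
  \int[mu]_(x in dyadic_itv j k) f x = \int[mu]_(x in dyadic_itv j.+1 k.*2) f x +
    \int[mu]_(x in dyadic_itv j.+1 k.*2.+1) f x.
Proof.
move=> fi; rewrite dyadic_itv_split Rintegral_setU//.
- by apply: integrableW => //; exact: measurableU.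
- apply/disj_setPS => x [/dyadic_itv_disj H /H]; lia.
Qed.

Lemma inner_haar_psi f j k : mu.-integrable setT (EFin \o f) ->
  L2_inner f (haar_psi j k) = \int[mu]_(x in dyadic_itv j.+1 k.*2) f x -
    \int[mu]_(x in dyadic_itv j.+1 k.*2.+1) f x.
Proof.
move=> fi; rewrite /L2_inner -(Rintegral_indic_mul _ (dyadic_itv j.+1 k.*2))
  -(Rintegral_indic_mul _ (dyadic_itv j.+1 k.*2.+1)).
rewrite -(@RintegralB _ _ _ mu setT (fun x => f x * \1_(dyadic_itv j.+1 k.*2) x)
  (fun x => f x * \1_(dyadic_itv j.+1 k.*2.+1) x))//.
- by apply: eq_Rintegral => x _; rewrite /haar_psi mulrBr.
- exact: integrable_indic_mul.
- exact: integrable_indic_mul.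
Qed.

Lemma indic_dyadic j k x : unit_itv x ->
  \1_(dyadic_itv j k) x = (dyadic_index j x == k)%:R :> R.
Proof.
move=> /unit_itvP/andP[x0 _]; rewrite indicE; congr (nat_of_bool _)%:R.
apply/idP/eqP => [/set_mem/dyadic_indexP -> //|kx].
by apply/mem_set/dyadic_indexP.
Qed.

(** By induction: a single Haar function of generation [j] lives around [x], and its term turns the
    mean over an interval into the mean over the half that contains [x]. *)
Lemma haar_sum_mean f j x : mu.-integrable setT (EFin \o f) -> unit_itv x ->
  haar_sum j f x = dyadic_mean f j (dyadic_index j x).
Proof.
move=> fi Ix; have /unit_itvP/andP[x0 x1] := Ix.
rewrite /haar_sum; elim: j => [|j IH].
  rewrite big_geq// addr0 /haar_phi /dyadic_mean expr0 mul1r /L2_inner.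
  have -> : dyadic_index 0 x = 0%N.
    by apply/eqP; have := dyadic_index_lt 0 Ix; rewrite expn0 ltnS leqn0.
  rewrite Rintegral_indic_mul indicE mem_set ?mulr1//.
  by have -> : dyadic_itv 0 0 = `[0, 1[%classic :> set R by rewrite /dyadic_itv expr0 !divr1.
rewrite big_nat_recr//= addrA IH big_mkord.
have kj := dyadic_index_lt j Ix.
rewrite (bigD1 (Ordinal kj))//= big1 => [|k kk]; last first.
  rewrite /haar_psi !indic_dyadic//.
  have half : (dyadic_index j.+1 x)./2 = dyadic_index j x by apply: dyadic_index_half.
  have ne : (k : nat) != dyadic_index j x by rewrite -val_eqE in kk.
  have -> : (dyadic_index j.+1 x == k.*2) = false.
    by apply/eqP => E; move: ne half; rewrite E doubleK => /eqP.
  have -> : (dyadic_index j.+1 x == k.*2.+1) = false.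
    by apply/eqP => E; move: ne half; rewrite E /= uphalf_double => /eqP.
  by rewrite subrr mulr0.
rewrite addr0 inner_haar_psi// /dyadic_mean (Rintegral_dyadic_split j (dyadic_index j x) fi).
rewrite /haar_psi !indic_dyadic// exprS -[dyadic_index j.+1 x]odd_double_half.
rewrite dyadic_index_half//; set k := dyadic_index j x.
case: (odd _) => /=.
  by rewrite add1n eqxx -[X in X == _]addn1 -[X in _ == X]addn0 eqn_add2l /=; ring.
by rewrite add0n eqxx -[X in _ - (X == _)%:R]addn0 -[X in (_ == X)%:R]addn1 eqn_add2l /=; ring.
Qed.

Lemma sum_double (a : nat -> R) n :
  \sum_(k < n.*2) a k = \sum_(k < n) (a k.*2 + a k.*2.+1).
Proof.
by elim: n => [|n IH]; rewrite ?big_ord0// doubleS !big_ord_recr /= IH addrA.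
Qed.

Lemma dyadic_additive_sum (Phi : nat -> nat -> R) :
  (forall j k, Phi j k = Phi j.+1 k.*2 + Phi j.+1 k.*2.+1) ->
  forall j, \sum_(k < 2 ^ j) Phi j k = Phi 0%N 0%N.
Proof.
move=> H; elim=> [|j IH]; first by rewrite big_ord1.
rewrite -IH expnS mul2n (sum_double (Phi j.+1)); apply: eq_bigr => k _.
by rewrite -H.
Qed.

Lemma integrable_cst01 (c : R) : mu.-integrable setT (EFin \o cst c).
Proof.
apply/integrableP; split; first by apply/measurable_EFinP; exact: measurable_cst.
rewrite -[X in (X < _)%E]/(\int[mu]_x cst `|c|%:E x)%E.
by rewrite integral_cst//= lebesgue01_setT mule1 ltry.
Qed.

Lemma lebesgue01_itv00 : dyadic_itv 0 0 = unit_itv :> set R.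
Proof. by rewrite /dyadic_itv expr0 !divr1. Qed.

Lemma Rintegral_unit_itv f : mu.-integrable setT (EFin \o f) ->
  \int[mu]_(x in dyadic_itv 0 0) f x = \int[mu]_x f x.
Proof.
move=> fi; rewrite lebesgue01_itv00 /Rintegral; congr fine.
have mI : measurable (unit_itv : set mR) by exact: measurable_itv.
have mu0 : mu (~` unit_itv) = 0%E by rewrite lebesgue01E setICl measure0.
by rewrite (negligible_integral (measurableC mI) measurableT fi mu0) setTD setCK.
Qed.

(** Jensen's inequality, obtained by integrating the square of [f - c] with [c] the mean. *)
Lemma Rintegral_sqr_mean f j k : sq_integrable f -> (k < 2 ^ j)%N ->
  dyadic_mean f j k ^+ 2 <= 2 ^+ j * \int[mu]_(x in dyadic_itv j k) (f x ^+ 2).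
Proof.
move=> f2 kj; rewrite /dyadic_mean; set A := dyadic_itv j k.
have mA : measurable (A : set mR) by exact: measurable_dyadic_itv.
have fi := integrableW mA (sq_integrable_int f2).
have ffi := integrableW mA (sq_integrable_sqr f2).
set I := Rintegral mu A f; set I2 := Rintegral _ _ _.
set c := 2 ^+ j * I.
have j0 : 0 < 2 ^+ j :> R by rewrite exprn_gt0.
have cst_i (a : R) : mu.-integrable A (EFin \o cst a).
  exact: integrableW (integrable_cst01 a).
have cfi : mu.-integrable A (EFin \o (fun x => 2 * c * f x)).
  by have := integrableZl mA (2 * c) fi; apply: eq_integrable.
have : 0 <= \int[mu]_(x in A) (f x ^+ 2 - 2 * c * f x + c ^+ 2).
  apply: Rintegral_ge0 => x _.
  have -> : f x ^+ 2 - 2 * c * f x + c ^+ 2 = (f x - c) ^+ 2 by ring.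
  exact: sqr_ge0.
rewrite (@RintegralD _ _ _ mu A (fun x => f x ^+ 2 - 2 * c * f x) (cst (c ^+ 2)))//; last first.
  by have := integrableB mA ffi cfi; apply: eq_integrable.
rewrite (@RintegralB _ _ _ mu A (fun x => f x ^+ 2) (fun x => 2 * c * f x))//.
rewrite (@RintegralZl _ _ _ mu A f)// Rintegral_cst// lebesgue01_dyadic//= -/I -/I2.
rewrite -(ler_pM2l j0) mulr0.
have -> : 2 ^+ j * (I2 - 2 * c * I + c ^+ 2 / 2 ^+ j) = 2 ^+ j * I2 - c ^+ 2.
  by rewrite /c; field; rewrite gt_eqF.
by rewrite subr_ge0.
Qed.

Lemma bessel f j : sq_integrable f ->
  \sum_(k < 2 ^ j) dyadic_mean f j k ^+ 2 <= 2 ^+ j * \int[mu]_x (f x ^+ 2).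
Proof.
move=> f2; have ffi := sq_integrable_sqr f2.
apply: (@le_trans _ _ (\sum_(k < 2 ^ j) 2 ^+ j * \int[mu]_(x in dyadic_itv j k) (f x ^+ 2))).
  by apply: ler_sum => k _; exact: Rintegral_sqr_mean.
rewrite -mulr_sumr ler_wpM2l ?exprn_ge0//.
rewrite (dyadic_additive_sum (Phi := fun j k => \int[mu]_(x in dyadic_itv j k) (f x ^+ 2))).
  by rewrite Rintegral_unit_itv.
by move=> i k; exact: (@Rintegral_dyadic_split (fun x => f x ^+ 2)).
Qed.

Lemma dyadic_mean_sqr_le f j k : sq_integrable f -> (k < 2 ^ j)%N ->
  dyadic_mean f j k ^+ 2 <= 2 ^+ j * \int[mu]_x (f x ^+ 2).
Proof.
move=> f2 kj; apply: le_trans (bessel j f2).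
by rewrite (bigD1 (Ordinal kj))//= lerDl sumr_ge0// => i _; exact: sqr_ge0.
Qed.

Lemma dyadic_meanB f g j k :
  mu.-integrable setT (EFin \o f) -> mu.-integrable setT (EFin \o g) ->
  dyadic_mean (f \- g) j k = dyadic_mean f j k - dyadic_mean g j k.
Proof.
move=> fi gi; rewrite /dyadic_mean -mulrBr; congr *%R.
have mA := measurable_dyadic_itv j k.
exact: RintegralB (integrableW mA fi) (integrableW mA gi).
Qed.

Lemma dyadic_mean_ae f g j k : measurable_fun setT f -> measurable_fun setT g ->
  f = g %[ae mu] -> dyadic_mean f j k = dyadic_mean g j k.
Proof.
move=> mf mg fg; rewrite /dyadic_mean; congr (_ * fine _).
have mA := measurable_dyadic_itv j k.
apply: ae_eq_integral => //.
- by apply/measurable_EFinP; exact: measurable_funTS mf.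
- by apply/measurable_EFinP; exact: measurable_funTS mg.
- by apply: filterS fg => x fgx _ /=; rewrite fgx.
Qed.

Definition dyadic_step j (c : nat -> R) : mR -> R :=
  fun x => \sum_(k < 2 ^ j) c k * \1_(dyadic_itv j k) x.

Lemma dyadic_stepE j c x k : (k < 2 ^ j)%N -> dyadic_itv j k x -> dyadic_step j c x = c k.
Proof.
move=> kj kx; rewrite /dyadic_step (bigD1 (Ordinal kj))//= big1 => [|i ik].
  by rewrite addr0 indicE mem_set// mulr1.
rewrite indicE memNset ?mulr0// => /dyadic_itv_disj/(_ kx) E.
by move: ik; rewrite -val_eqE /= E eqxx.
Qed.

Lemma dyadic_step_out j c x : ~ unit_itv x -> dyadic_step j c x = 0.
Proof.
move=> Ix; rewrite /dyadic_step big1// => i _.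
by rewrite indicE memNset ?mulr0// => /(dyadic_itv_unit (ltn_ord i)).
Qed.

Lemma measurable_dyadic_step j c : measurable_fun setT (dyadic_step j c).
Proof.
by apply: measurable_sum => k; apply: measurable_funM.
Qed.

Lemma dyadic_step_sqr j c x : dyadic_step j c x ^+ 2 = dyadic_step j (fun k => c k ^+ 2) x.
Proof.
have [Ix|Ix] := pselect (unit_itv x); last by rewrite !dyadic_step_out// expr0n.
have kj := dyadic_index_lt j Ix; have /unit_itvP/andP[x0 _] := Ix.
have kx : dyadic_itv j (dyadic_index j x) x by apply/dyadic_indexP.
by rewrite !(dyadic_stepE _ kj kx).
Qed.

Lemma integral_dyadic_step j c : (forall k, 0 <= c k) ->
  (\int[mu]_x (dyadic_step j c x)%:E = (2 ^- j * \sum_(k < 2 ^ j) c k)%:E)%E.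
Proof.
move=> c0; rewrite mulr_sumr -sumEFin.
under eq_integral => x _ do rewrite /dyadic_step -sumEFin.
rewrite ge0_integral_sum//=; last 2 first.
- by move=> k; apply/measurable_EFinP; apply: measurable_funM.
- by move=> k x _; rewrite lee_fin mulr_ge0.
apply: eq_bigr => k _; have mA := measurable_dyadic_itv j k.
under eq_integral do rewrite EFinM.
rewrite ge0_integralZl//=; last 2 first.
- by apply/measurable_EFinP.
- by rewrite lee_fin.
by rewrite integral_indic// setIT lebesgue01_dyadic// -EFinM mulrC.
Qed.

Lemma dyadic_step_sq_integrable j c : sq_integrable (dyadic_step j c).
Proof.
apply: sq_integrableP; first exact: measurable_dyadic_step.
under eq_integral => x _ do rewrite dyadic_step_sqr.
by rewrite integral_dyadic_step ?ltry// => k; exact: sqr_ge0.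
Qed.

Lemma Rintegral_dyadic_step_sqr j c :
  \int[mu]_x (dyadic_step j c x ^+ 2) = 2 ^- j * \sum_(k < 2 ^ j) c k ^+ 2.
Proof.
rewrite /Rintegral; under eq_integral => x _ do rewrite dyadic_step_sqr.
by rewrite integral_dyadic_step// => k; exact: sqr_ge0.
Qed.

Lemma dyadic_mean_step j c k : (k < 2 ^ j)%N -> dyadic_mean (dyadic_step j c) j k = c k.
Proof.
move=> kj; rewrite /dyadic_mean (@eq_Rintegral _ _ _ _ _ (fun=> c k)); last first.
  by move=> x /set_mem kx; rewrite (dyadic_stepE _ kj kx).
rewrite Rintegral_cst ?lebesgue01_dyadic//=.
by rewrite mulrCA mulfV ?mulr1// expf_neq0.
Qed.

Lemma L2_sq_integrable (f : L2 R) : sq_integrable f.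
Proof.
rewrite /sq_integrable inE; apply/andP; split; rewrite inE//=.
  exact: measurable_L2.
exact: (@Lebesgue_finite _ _ _ _ _ _ f).
Qed.

Lemma L2_of_sq_integrable f : sq_integrable f ->
  exists F : L2 R, (F : mR -> R) = f %[ae mu].
Proof.
move=> f2; have mf := sq_integrable_meas f2.
have mf' : measurable_fun setT (f : mR -> mR) := mf.
pose f' : {mfun mR >-> mR} := HB.pack (f : mR -> mR)
  (@isMeasurableFun.Build _ _ mR mR f mf').
pose q : {mfun_ mu, mR >-> mR} := \pi_({mfun_ mu, mR >-> mR})%qT f'.
have qf : (repr q : mR -> R) = f %[ae mu].
  have /eqmodP/asboolP : (repr q = f' %[mod {mfun_ mu, mR >-> mR}])%qT by rewrite reprK.
  by [].
have q2 : sq_integrable (repr q).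
  apply: sq_integrableP; first exact: measurable_funPT (repr q).
  have /integrableP[_] := sq_integrable_sqr f2; apply: le_lt_trans.
  rewrite le_eqVlt; apply/orP; left; apply/eqP.
  apply: ae_eq_integral => //.
  - by apply/measurable_EFinP/measurable_funX; exact: measurable_funPT (repr q).
  - apply: measurableT_comp => //; apply/measurable_EFinP/measurable_funX.
    exact: mf.
  - apply: filterS qf => x qfx _ /=.
    by rewrite (qfx I) ger0_norm// sqr_ge0.
have qfin : finite_norm mu 2%:E (repr q).
  by move: q2; rewrite /sq_integrable inE => /andP[_]; rewrite inE.
pose F : L2 R := HB.pack q (isFinLebesgue.Build _ _ _ mu 2%:E (lee1n 2) q qfin).
by exists F.
Qed.

Lemma L2_dist_sqr (f g : L2 R) : L2_dist f g ^+ 2 = \int[mu]_x ((f x - g x) ^+ 2).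
Proof.
have E : ('N[mu]_2%:E[EFin \o (f \- g)%R] `^ 2 = \int[mu]_x ((f x - g x) ^+ 2)%:E)%E.
  rewrite poweR_Lnorm//; apply: eq_integral => x _.
  by rewrite /= powR_mulrn// real_normK ?num_real.
rewrite /Rintegral -E -L2_distE poweR_EFin /= powR_mulrn// /L2_dist fine_ge0//.
exact: Lnorm_ge0.
Qed.

End lebesgue01_dyadic.

(** * Growth rates and upper bounds *)

Section upper_lower_limits.
Context {R : realType}.
Implicit Types (u : (\bar R)^nat) (b c : R) (J j : nat).
Local Open Scope ereal_scope.

Lemma lt_limn_esup u b c : b%:E <= limn_esup u -> (c < b)%R ->
  forall J, exists2 j, (J <= j)%N & c%:E <= u j.
Proof.
move=> ub cb J.
have : c%:E < ereal_sup (u @` [set j | (J <= j)%N]).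
  apply: (@lt_le_trans _ _ b%:E); first by rewrite lte_fin.
  by apply: le_trans ub _; apply: ereal_inf_lbound; exists [set j | (J <= j)%N] => //; exists J.
by move=> /ereal_sup_gt[_ [j /= Jj <-] /ltW]; exists j.
Qed.

Lemma limn_esup_le u b :
  (forall c, (b < c)%R -> exists J, forall j, (J <= j)%N -> u j <= c%:E) ->
  limn_esup u <= b%:E.
Proof.
move=> H; apply/lee_addgt0Pr => e e0.
have [|J HJ] := H (b + e)%R; first by rewrite ltrDl.
apply: le_trans (ereal_inf_lbound _) _; first by exists [set j | (J <= j)%N] => //; exists J.
by apply: ge_ereal_sup => _ [j /= Jj <-]; exact: HJ.
Qed.

Lemma limn_esup_ge u b :
  (forall c, (c < b)%R -> forall J, exists2 j, (J <= j)%N & c%:E <= u j) ->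
  b%:E <= limn_esup u.
Proof.
move=> H; apply: le_ereal_inf_tmp => _ [A [J _ JA] <-].
apply/lee_subgt0Pr => e e0.
have [|j Jj uj] := H (b - e)%R _ J; first by rewrite ltrBlDr ltrDl.
by apply: le_trans uj _; apply: ereal_sup_ubound; exists j => //; exact: JA.
Qed.

Lemma lt_limn_einf u b c : b%:E <= limn_einf u -> (c < b)%R ->
  exists J, forall j, (J <= j)%N -> c%:E <= u j.
Proof.
rewrite /limn_einf leeNr => ub cb.
have : limn_esup (\- u) < (- c)%:E by apply: le_lt_trans ub _; rewrite lte_fin ltrN2.
move=> /ereal_inf_lt[_ [A [J _ JA] <-] /ltW supA].
exists J => j Jj; rewrite -leeN2 -EFinN; apply: le_trans supA.
by apply: ereal_sup_ubound; exists j => //; exact: JA.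
Qed.

Lemma cvg_of_bounds u b :
  (forall c, (c < b)%R -> exists J, forall j, (J <= j)%N -> c%:E <= u j) ->
  (forall c, (b < c)%R -> exists J, forall j, (J <= j)%N -> u j <= c%:E) ->
  u @ \oo --> b%:E.
Proof.
move=> lo hi.
have H (e : R) : (0 < e)%R -> exists J, forall j, (J <= j)%N ->
    (`|fine (u j) - b| <= e)%R /\ u j \is a fin_num.
  move=> e0.
  have [|J1 H1] := lo (b - e)%R; first by rewrite ltrBlDr ltrDl.
  have [|J2 H2] := hi (b + e)%R; first by rewrite ltrDl.
  exists (maxn J1 J2) => j; rewrite geq_max => /andP[/H1 + /H2].
  by case: (u j) => //= r; rewrite !lee_fin ler_norml => ? ?; split => //; lra.
apply/fine_cvgP; split.
  by have [J HJ] := H 1%R ltr01; exists J => // j /= /HJ[].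
apply/cvgrPdist_le => e /H[J HJ]; exists J => // j /= /HJ[+ _].
by rewrite distrC.
Qed.

End upper_lower_limits.

Section haar_rate.
Context {R : realType}.
Implicit Types (f : R -> R) (x b c s : R) (j J k : nat).

Lemma haar_rate_ge f x c j : (0 < j)%N ->
  (c%:E <= haar_rate f x j)%E = (2 `^ (c * j%:R) <= `|haar_sum j f x|).
Proof.
move=> j0; rewrite /haar_rate.
have jl : 0 < j%:R * ln 2 :> R by rewrite mulr_gt0 ?ltr0n ?ln_gt0 ?ltr1n.
rewrite lee_pdivlMr// -EFinM.
(* Where the partial sum vanishes the rate is -oo, and both sides are false. *)
have [->|T0] := eqVneq (haar_sum j f x) 0.
  by rewrite normr0 le0_lneNy// leNgt [in LHS]ltNyr leNgt powR_gt0.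
rewrite lne_EFin ?normr_gt0// lee_fin -[in RHS](@lnK _ `|_|) ?posrE ?normr_gt0//.
by rewrite /powR pnatr_eq0 /= ler_expR mulrA.
Qed.

Definition large_at f c x : set nat := [set j | 2 `^ (c * j%:R) <= `|haar_sum j f x|].

Definition limsup_large f c : set R :=
  [set x | unit_itv x /\ forall J, exists2 j, (J <= j)%N & large_at f c x j].

Definition liminf_large f c : set R :=
  [set x | unit_itv x /\ exists J, forall j, (J <= j)%N -> large_at f c x j].

Lemma E_minus_limsup_large f b c : c < b -> E_minus b f `<=` limsup_large f c.
Proof.
move=> cb x [Ix lx]; split => // J.
have [|j Jj] := @lt_limn_esup _ (haar_rate f x) b c _ cb J.+1; first by rewrite lx.
rewrite haar_rate_ge ?(leq_trans _ Jj)// => H.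
by exists j => //; exact: ltnW.
Qed.

Lemma E_plus_liminf_large f b c : c < b -> E_plus b f `<=` liminf_large f c.
Proof.
move=> cb x [Ix lx]; split => //; have [J HJ] := lt_limn_einf lx cb.
exists J.+1 => j Jj; rewrite /large_at /= -haar_rate_ge ?(leq_trans _ Jj)//.
exact/HJ/ltnW.
Qed.

Lemma E_lim_minus f b : E_lim b f `<=` E_minus b f.
Proof.
by move=> x [Ix lx]; split => //; have [] := cvg_limn_einf_sup lx.
Qed.

Lemma E_lim_plus f b : E_lim b f `<=` E_plus b f.
Proof.
by move=> x [Ix lx]; split => //; have [-> _] := cvg_limn_einf_sup lx.
Qed.

Lemma not_limsup_large f c x : unit_itv x -> ~ limsup_large f c x ->
  exists J, forall j, (J <= j)%N -> (haar_rate f x j <= c%:E)%E.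
Proof.
move=> Ix H.
have [J HJ] : exists J, forall j, (J <= j)%N -> ~ large_at f c x j.
  apply: contrapT => K; apply: H; split => // J.
  apply: contrapT => L; apply: K; exists J => j Jj lj; apply: L; by exists j.
exists J.+1 => j Jj; have /negP := HJ _ (ltnW Jj).
by rewrite -haar_rate_ge ?(leq_trans _ Jj)// -ltNge => /ltW.
Qed.

Section upper_bounds.
Variables (f : R -> R) (c s : R).
Hypotheses (f2 : sq_integrable f) (s_gt0 : 0 < s) (sc : 1 - 2 * c < s).

Let S j k := 2 `^ (c * j%:R) <= `|dyadic_mean f j k|.
Let M := \int[lebesgue01 R]_x (f x ^+ 2).
Let b := 2 `^ (1 - 2 * c) : R.

Let M_ge0 : 0 <= M.
Proof. by apply: Rintegral_ge0 => x _; exact: sqr_ge0. Qed.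

Let ratio : 2 `^ (- s) * b < 1.
Proof.
rewrite -powRD; last by rewrite pnatr_eq0 implybT.
have -> : - s + (1 - 2 * c) = - (s - (1 - 2 * c)) by ring.
by have /andP[] := powR_half_lt1 (eqbRL (subr_gt0 _ _) sc).
Qed.

(** Chebyshev's inequality applied to [bessel]. *)
Let count j : \sum_(k < 2 ^ j) (S j k)%:R <= M * b ^+ j.
Proof.
have p0 : 0 < 2 `^ (2 * (c * j%:R)) :> R by rewrite powR_gt0.
rewrite -(ler_pM2r p0) mulr_suml.
apply: (@le_trans _ _ (\sum_(k < 2 ^ j) dyadic_mean f j k ^+ 2)).
  apply: ler_sum => k _; case E : (S j k); last by rewrite mul0r sqr_ge0.
  rewrite mul1r mulrC powRrM powR_mulrn ?powR_ge0// -[leRHS]real_normK ?num_real//.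
  by rewrite lerXn2r ?nnegrE ?powR_ge0.
apply: le_trans (bessel j f2) _; rewrite mulrC -mulrA ler_wpM2l//.
rewrite /b -!powR_mulrn ?powR_ge0// -powRrM -powRD; last by rewrite pnatr_eq0 implybT.
by rewrite (_ : _ + _ = j%:R)//; ring.
Qed.

Lemma limsup_large_null A : A `<=` limsup_large f c -> hausdorff_measure s A = 0%E.
Proof.
move=> AL; apply: (hausdorff_limsup_set s_gt0 M_ge0 (powR_ge0 _ _) ratio count).
move=> x /AL[Ix H]; split => // J; have [j Jj] := H J.
rewrite /large_at /= (haar_sum_mean _ (sq_integrable_int f2) Ix) => L.
by exists j.
Qed.

Lemma liminf_large_null A : A `<=` liminf_large f c -> packing_measure s A = 0%E.
Proof.
move=> AL; apply: (packing_liminf s_gt0 M_ge0 (powR_ge0 _ _) ratio count).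
move=> x /AL[Ix [J H]]; split => //; exists J => j /H.
by rewrite /large_at /= (haar_sum_mean _ (sq_integrable_int f2) Ix).
Qed.

End upper_bounds.

Lemma hausdorff_dim_E_minus f b A : sq_integrable f -> 0 <= b <= 1 / 2 ->
  A `<=` E_minus b f -> (hausdorff_dim A <= (1 - 2 * b)%:E)%E.
Proof.
move=> f2 b01 AE; apply/lee_addgt0Pr => e e0.
apply: ereal_inf_lbound; exists (1 - 2 * b + e) => //; split; first lra.
(* The critical exponent for this threshold is 1 - 2b + e/2, below 1 - 2b + e. *)
apply: (@limsup_large_null f (b - e / 4)) => //; [lra|lra|].
by apply: subset_trans AE _; apply: E_minus_limsup_large; lra.
Qed.

Lemma packing_dim_E_plus f b A : sq_integrable f -> 0 <= b <= 1 / 2 ->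
  A `<=` E_plus b f -> (packing_dim A <= (1 - 2 * b)%:E)%E.
Proof.
move=> f2 b01 AE; apply/lee_addgt0Pr => e e0.
apply: ereal_inf_lbound; exists (1 - 2 * b + e) => //; split; first lra.
apply: (@liminf_large_null f (b - e / 4)) => //; [lra|lra|].
by apply: subset_trans AE _; apply: E_plus_liminf_large; lra.
Qed.

End haar_rate.

(** * Lower bounds and saturating functions *)

(** Outer measures push forward along arbitrary maps, and the mass distribution principle uses only
    monotonicity and countable subadditivity. *)
Lemma outer_measure_preimage (R : realType) (T : Type)
    (lam : {outer_measure set T -> \bar R}) (D : set T) (G : T -> R) :
  exists mu : {outer_measure set R -> \bar R},
    forall A, mu A = lam [set t | D t /\ A (G t)].
Proof.
pose m (A : set R) := lam [set t | D t /\ A (G t)].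
have m0 : m set0 = 0%E.
  by rewrite /m (_ : [set t | _] = set0) ?outer_measure0//; apply/seteqP; split => t [].
have m_ge0 A : (0 <= m A)%E by exact: outer_measure_ge0.
have m_le : {homo m : A B / A `<=` B >-> (A <= B)%E}.
  by move=> A B AB; apply: le_outer_measure => t /= [Dt /AB].
have m_sub : sigma_subadditive m.
  move=> F; apply: le_trans (outer_measure_sigma_subadditive lam _).
  by apply: le_outer_measure => t /= [Dt [n _ FnG]]; exists n.
pose mu : {outer_measure set R -> \bar R} :=
  HB.pack m (isOuterMeasure.Build R R m m0 m_ge0 m_le m_sub).
by exists mu.
Qed.

Section lebesgue_outer.
Context {R : realType}.

(* [lebesgue_measure] is the restriction of this outer measure to Borel sets. *)
Definition lebesgue_outer : {outer_measure set (ocitv_type R) -> \bar R} :=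
  mu_ext (wlength [the cumulative R R of idfun]).

Lemma lebesgue_outerE (A : set R) : lebesgue_outer A = lebesgue_measure A.
Proof. by []. Qed.

Lemma lebesgue_outer_unit : lebesgue_outer unit_itv = 1%E.
Proof. by rewrite lebesgue_outerE lebesgue_measure_unit. Qed.

Lemma lebesgue_outer_dyadic j k : lebesgue_outer (dyadic_itv j k) = (2 ^- j)%:E.
Proof. by rewrite lebesgue_outerE lebesgue_measure_dyadic. Qed.

End lebesgue_outer.

Section insertion_measure.
Context {R : realType}.
Implicit Types (f : R -> R) (a b s t x : R) (A : set R) (j k : nat).

Definition insertion_set a : set R :=
  [set x | unit_itv x /\ exists2 t, unit_itv t &
    forall j, dyadic_index j x = insert_index a t j].

(** The image of Lebesgue outer measure under insertion. By [insert_index_inj] an interval of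
    generation [j] pulls back into one of generation [rank a j], and [rank a j] is a j - o(j). *)
Lemma insertion_measure a : 0 <= a <= 1 ->
  exists mu : {outer_measure set R -> \bar R},
  [/\ mu (~` unit_itv) = 0%E,
      (1 <= mu (insertion_set a))%E &
      forall s, s < a -> exists2 C, 0 <= C &
        forall j k, (mu (dyadic_itv j k) <= (C * (2 `^ (- s)) ^+ j)%:E)%E].
Proof.
move=> a01.
have /choice[G GP] : forall t, exists x, unit_itv t ->
    unit_itv x /\ forall j, dyadic_index j x = insert_index a t j.
  move=> t; have [It|] := pselect (unit_itv t); last by exists 0.
  by have [x xP] := insert_point a It; exists x.
have [mu muE] := outer_measure_preimage lebesgue_outer unit_itv G.
exists mu; split.
- rewrite muE (_ : [set t | _] = set0) ?outer_measure0//.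
  by apply/seteqP; split => // t [/GP[IG _] /(_ IG)].
- rewrite muE -lebesgue_outer_unit; apply: le_outer_measure => t It; split => //=.
  by have [IG HG] := GP _ It; split => //; exists t.
(* With 2^-n < a - s the discrepancy is at most n + (a - s) j, whence [C] = 2^n. *)
move=> s sa; have [n na] := half_exp_small (eqbRL (subr_gt0 _ _) sa).
exists (2 ^+ n); first by rewrite exprn_ge0.
move=> j k; rewrite muE.
have [->|/set0P[t0 /= [It0 kt0]]] := eqVneq [set t | unit_itv t /\ dyadic_itv j k (G t)] set0.
  by rewrite outer_measure0 lee_fin mulr_ge0 ?exprn_ge0 ?powR_ge0.
have idx t : unit_itv t -> dyadic_itv j k (G t) -> insert_index a t j = k.
  move=> It; have [IG HG] := GP _ It; have /unit_itvP/andP[G0 _] := IG.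
  by move=> /(dyadic_indexP _ _ G0); rewrite HG.
apply: (@le_trans _ _ (lebesgue_outer
    (dyadic_itv (rank a j) (dyadic_index (rank a j) t0)))).
  apply: le_outer_measure => t /= [It kt]; have /unit_itvP/andP[t0' _] := It.
  apply/dyadic_indexP => //; apply: insert_index_inj => //.
  by rewrite !idx.
rewrite lebesgue_outer_dyadic lee_fin -!powR_invn// -powR_mulrn// -powR_mulrn ?powR_ge0//.
rewrite -powRrM -powRD; last by rewrite pnatr_eq0 implybT.
rewrite ler_powR ?ler1n//.
have := rank_discrepancy n j a01; rewrite ler_norml => /andP[H _].
have : j%:R / 2 ^+ n <= (a - s) * j%:R by rewrite mulrC ler_wpM2r// ltW.
by move: H; lra.
Qed.

(** The points of the insertion set where the limsup exceeds [b] form a null set for the insertion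
    measure, so [A] keeps positive mass. Callers only have to supply lower bounds on the growth. *)
Lemma dim_lower_bound f b A : sq_integrable f -> 0 <= b <= 1 / 2 ->
  (forall x, insertion_set (1 - 2 * b) x ->
     (limn_esup (haar_rate f x) <= b%:E)%E -> A x) ->
  ((1 - 2 * b)%:E <= hausdorff_dim A)%E /\ ((1 - 2 * b)%:E <= packing_dim A)%E.
Proof.
move=> f2 b01 HA; set a : R := 1 - 2 * b.
have a01 : 0 <= a <= 1 by rewrite /a; lra.
have [mu [mu_unit mu_ins mu_dy]] := insertion_measure a01.
(* For [b] = 1/2 there is no such [s], and the bound by 0 is trivial. *)
have key s : 0 < s -> s < a -> mu A <> 0%E.
  move=> s0 sa muA.
  pose bad m := limsup_large f (b + m.+1%:R^-1).
  have mu_large e : 0 < e -> mu (limsup_large f (b + e)) = 0%E.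
    (* Positive, below [a], and above the critical exponent a - 2e of the threshold b + e. *)
    move=> e0; pose s' := Num.max (a / 2) (a - e).
    have s'0 : 0 < s' by rewrite lt_max; apply/orP; left; lra.
    have s'a : s' < a by rewrite gt_max; apply/andP; split; lra.
    have [C C0 muC] := mu_dy _ s'a.
    apply: (mass_hausdorff s'0 C0 mu_unit muC).
    apply: (@limsup_large_null _ f (b + e)) => //.
    by rewrite lt_max; apply/orP; right; rewrite /a; lra.
  have mu_bad m : mu (bad m) = 0%E by apply: mu_large; rewrite invr_gt0.
  have : (mu (insertion_set a) <= mu (A `|` \bigcup_m bad m))%E.
    apply: le_outer_measure => x xa; have [Ix _] := xa.
    have [|nbad] := pselect ((\bigcup_m bad m) x); first by right.
    left; apply: HA => //; apply: limn_esup_le => c bc.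
    have cb0 : 0 < c - b by rewrite subr_gt0.
    have [m mc] : exists m, m.+1%:R^-1 < c - b.
      exists (Num.truncn (c - b)^-1); rewrite invf_plt ?posrE//.
      by have /andP[] := truncn_itv (ltW (eqbRL (invr_gt0 _) cb0)).
    have [|J HJ] := @not_limsup_large _ f (b + m.+1%:R^-1) x Ix.
      by move=> bx; apply: nbad; exists m.
    by exists J => j /HJ /le_trans; apply; rewrite lee_fin -lerBrDl ltW.
  move/(le_trans mu_ins); rewrite leNgt => /negP; apply.
  apply: le_lt_trans (outer_measureU2 _ _ _) _; rewrite muA add0e.
  apply: le_lt_trans (outer_measure_sigma_subadditive _ _) _.
  by rewrite eseries0// => m _ _.
split; apply: le_ereal_inf_tmp => _ [s [s0 As] <-]; rewrite lee_fin leNgt;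
  apply/negP => sa; apply: (key s s0 sa); have [C C0 muC] := mu_dy _ sa.
- exact: mass_hausdorff s0 C0 mu_unit muC _ As.
- exact: (mass_packing C0 mu_unit muC).
Qed.

End insertion_measure.

(** * Densities that are large on all the sets [K_a] at once *)

Section saturating_density.
Context {R : realType}.
Implicit Types (a b c t d K : R) (j k m n J : nat).

Lemma const_le_exp d K : 0 < d ->
  exists J, forall j, (J <= j)%N -> K <= 2 `^ (d * j%:R).
Proof.
move=> d0; have /andP[z0 z1] := powR_half_lt1 d0.
have z01 : 0 <= (2 : R) `^ (- d) < 1 by rewrite ltW.
have [J HJ] := geometric_small K z01 ltr01.
exists J => j /HJ/ltW; rewrite -powR_mulrn ?powR_ge0// -powRrM mulNr powRN.
by rewrite ler_pdivrMr ?mul1r// powR_gt0.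
Qed.

Lemma poly_le_exp d K n : 0 < d -> 0 <= K ->
  exists J, forall j, (J <= j)%N -> K * (j + 3)%:R ^+ n <= 2 `^ (d * j%:R).
Proof.
(* The exponent is shared by the [n] factors of the power and by the constant. *)
move=> d0 K0; pose e := d / (n.+1)%:R.
have e0 : 0 < e by rewrite divr_gt0.
have l2 : 0 < ln 2 :> R by rewrite ln_gt0 ?ltr1n.
have el : 0 < e * ln 2 by rewrite mulr_gt0.
pose C := 3 + (e * ln 2)^-1.
have C0 : 0 <= C by rewrite addr_ge0// invr_ge0 ltW.
have HC j : (j + 3)%:R <= C * 2 `^ (e * j%:R).
  apply: (@le_trans _ _ (C * (1 + e * j%:R * ln 2))).
    have -> : C * (1 + e * j%:R * ln 2) =
      3 + 3 * (e * ln 2 * j%:R) + (e * ln 2)^-1 + j%:R.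
      by rewrite /C; field; rewrite !gt_eqF.
    rewrite natrD.
    have : 0 <= 3 * (e * ln 2 * j%:R) by rewrite mulr_ge0// mulr_ge0// ltW.
    have : 0 <= (e * ln 2)^-1 by rewrite invr_ge0 ltW.
    lra.
  rewrite ler_wpM2l// /powR pnatr_eq0 /= expR_ge1Dx//.
have [J HJ] := const_le_exp (K * C ^+ n) e0.
exists J => j /HJ H.
apply: (@le_trans _ _ (K * (C * 2 `^ (e * j%:R)) ^+ n)).
  by rewrite ler_wpM2l// lerXn2r ?nnegrE ?mulr_ge0 ?powR_ge0.
rewrite exprMn mulrA; apply: le_trans (ler_wpM2r _ H) _.
  by rewrite exprn_ge0// powR_ge0.
rewrite -powR_mulrn ?powR_ge0// -powRrM -powRD; last by rewrite pnatr_eq0 implybT.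
rewrite ler_powR ?ler1n// le_eqVlt; apply/orP; left; apply/eqP.
by rewrite /e -(natr1 n); field; rewrite natr1 pnatr_eq0.
Qed.

(* The thresholds run over a grid of mesh [1 / j.+1], which makes [saturating j]
   large on every [insertion_set a] at once; the last one exceeds 1 and
   contributes the constant 1. *)
Definition saturating j k : R := \sum_(m < j.+3) zero_density (m%:R / j.+1%:R) j k.

Lemma zero_density_sum th j : \sum_(k < 2 ^ j) zero_density th j k = 2 ^+ j :> R.
Proof.
elim: j => [|j IH]; first by rewrite big_ord1.
rewrite expnS mul2n (sum_double (zero_density th j.+1)) exprS -IH mulr_sumr.
by apply: eq_bigr => k _; rewrite zero_density_split.
Qed.

Lemma saturating_sum j : \sum_(k < 2 ^ j) saturating j k = j.+3%:R * 2 ^+ j.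
Proof.
rewrite exchange_big/= (eq_bigr (fun=> 2 ^+ j)) => [|m _]; last exact: zero_density_sum.
by rewrite sumr_const card_ord mulr_natl.
Qed.

Lemma saturating_ge0 j k : 0 <= saturating j k.
Proof. by apply: sumr_ge0 => m _; exact: zero_density_ge0. Qed.

Lemma saturating_ge1 j k : 1 <= saturating j k.
Proof.
rewrite /saturating big_ord_recr /= zero_density_ge1; last first.
  by rewrite ler_pdivlMr ?ltr0n// mul1r ler_nat.
by rewrite lerDr sumr_ge0// => m _; exact: zero_density_ge0.
Qed.

(** Only the term of the first grid point [th] above [a] is kept. It exceeds [a] by at most 1 /
    j.+1, which costs 1 in the exponent; the rest of the loss is the discrepancy. *)
Lemma saturating_insert n a t j : 0 <= a <= 1 ->
  2 `^ ((1 - a) * j%:R - 1 - n%:R - j%:R / 2 ^+ n) <=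
  saturating j (insert_index a t j).
Proof.
move=> a01; pose m := (Num.truncn (a * j.+1%:R)).+1.
have aj0 : 0 <= a * j.+1%:R by rewrite mulr_ge0//; lra.
have /andP[m1 m2] := truncn_itv aj0.
have mj : (m < j.+3)%N.
  rewrite /m !ltnS -(ler_nat R) (le_trans m1)//.
  by rewrite (@le_trans _ _ j.+1%:R)// ?ler_nat// ler_piMl//; lra.
pose th := m%:R / j.+1%:R : R.
have ath : a <= th by rewrite /th ler_pdivlMr ?ltr0n// ltW.
have thj : th * j%:R <= a * j%:R + 1.
  have : th * j.+1%:R <= a * j.+1%:R + 1.
    by rewrite /th divfK ?pnatr_eq0// /m -natr1; move: m1; lra.
  by rewrite -natr1; lra.
rewrite /saturating (bigD1 (Ordinal mj))//= -/th zero_density_insert//.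
rewrite -[leLHS]addr0; apply: lerD; last first.
  by apply: sumr_ge0 => i _; exact: zero_density_ge0.
rewrite -powR_mulrn// ler_powR ?ler1n// natrB ?rank_le//.
have : (rank th j)%:R <= th * j%:R + n%:R + j%:R / 2 ^+ n.
  have jn : 0 <= j%:R / 2 ^+ n :> R by rewrite divr_ge0 ?exprn_ge0.
  have n0 : 0 <= n%:R :> R by [].
  have [th1|/ltW th1] := leP th 1.
    have th01 : 0 <= th <= 1 by lra.
    by have := rank_discrepancy n j th01; rewrite ler_norml; lra.
  rewrite rank_ge1//; have : j%:R <= th * j%:R by rewrite ler_peMl.
  lra.
by move: thj; lra.
Qed.

(** The cubic factor is room for [weight_seq], whose inverse is a cubic polynomial. *)
Lemma saturating_lower b c : 0 <= b <= 1 / 2 -> c < b ->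
  exists J, forall j t, (J <= j)%N ->
  (j + 3)%:R ^+ 3 * 2 `^ (2 * c * j%:R) <= saturating j (insert_index (1 - 2 * b) t j).
Proof.
move=> b01 cb; have d0 : 0 < (b - c) / 2 by lra.
have [n nd] := half_exp_small d0.
have [J HJ] := @poly_le_exp ((b - c) / 2) (2 `^ (1 + n%:R)) 3 d0 (powR_ge0 _ _).
have a01 : 0 <= 1 - 2 * b <= 1 by lra.
exists J => j t /HJ H; apply: le_trans (saturating_insert n t j a01).
rewrite -(ler_pM2l (powR_gt0 (1 + n%:R) (ltr0Sn R 1))) mulrA.
apply: le_trans (ler_wpM2r (powR_ge0 _ _) H) _.
rewrite -!powRD ?pnatr_eq0 ?implybT// ler_powR ?ler1n//.
have : j%:R / 2 ^+ n <= (b - c) / 2 * j%:R by rewrite mulrC ler_wpM2r// ltW.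
have : 0 <= (b - c) * j%:R by rewrite mulr_ge0// subr_ge0 ltW.
lra.
Qed.

End saturating_density.

(** * The extremal function and the residual set *)

Section saturating_functions.
Context {R : realType}.
Local Notation mu := (lebesgue01 R).

(* The [j]-th weight [w_j] times [\int saturating j = j + 3] is telescoping. *)
Definition weight_seq j : R := (j.+1%:R * j.+2%:R * j.+3%:R)^-1.

Lemma weight_seq_gt0 j : 0 < weight_seq j.
Proof. by rewrite invr_gt0 !mulr_gt0. Qed.

Lemma weight_seq_series : (\sum_(j <oo) (weight_seq j * j.+3%:R)%:E <= 1)%E.
Proof.
have w0 j : 0 <= weight_seq j * j.+3%:R by rewrite mulr_ge0// ltW// weight_seq_gt0.
apply: lime_le; first by apply: is_cvg_nneseries => j _ _; rewrite lee_fin.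
apply: nearW => n; rewrite sumEFin lee_fin.
rewrite (_ : \sum_(_ <= _ < _) _ = 1 - n.+1%:R^-1) ?lerBlDr ?lerDl ?invr_ge0//.
elim: n => [|n IH]; first by rewrite big_geq// invr1 subrr.
rewrite big_nat_recr//= IH /weight_seq.
have H k : k.+1%:R != 0 :> R by rewrite pnatr_eq0.
have := H n; have := H n.+1; have := H n.+2.
rewrite -(natr1 n.+2) -(natr1 n.+1) -(natr1 n) => *; field; apply/and3P; split => //.
Qed.

Definition saturating_series (x : measurableTypeR R) : \bar R :=
  (\sum_(j <oo) (weight_seq j * dyadic_step j (saturating j) x)%:E)%E.

(** [fine] gives 0 where the series is infinite, which by its integral happens only on a null
    set. *)
Definition saturating_fun (x : measurableTypeR R) : R :=
  Num.sqrt (fine (saturating_series x)).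

Lemma dyadic_step_ge0 j (c : nat -> R) x : (forall k, 0 <= c k) -> 0 <= dyadic_step j c x.
Proof. by move=> c0; apply: sumr_ge0 => k _; rewrite mulr_ge0. Qed.

Let term_ge0 j x : (0 <= (weight_seq j * dyadic_step j (saturating j) x)%:E)%E.
Proof.
rewrite lee_fin mulr_ge0 ?(ltW (weight_seq_gt0 _)) ?dyadic_step_ge0// => k.
exact: saturating_ge0.
Qed.

Lemma saturating_series_ge0 x : (0 <= saturating_series x)%E.
Proof. by apply: nneseries_ge0 => j _ _; exact: term_ge0. Qed.

Let measurable_term j : measurable_fun setT
  (fun x : measurableTypeR R => (weight_seq j * dyadic_step j (saturating j) x)%:E).
Proof.
apply/measurable_EFinP; apply: measurable_funM => //; exact: measurable_dyadic_step.
Qed.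

Lemma measurable_saturating_series : measurable_fun setT saturating_series.
Proof.
apply: ge0_emeasurable_sum => [j x _ _|j _]; [exact: term_ge0|exact: measurable_term].
Qed.

Lemma integral_saturating_series : (\int[mu]_x saturating_series x <= 1)%E.
Proof.
rewrite integral_nneseries//.
apply: le_trans weight_seq_series; rewrite le_eqVlt; apply/orP; left; apply/eqP.
apply: eq_eseriesr => j _; under eq_integral do rewrite EFinM.
rewrite ge0_integralZl//; last 3 first.
- by apply/measurable_EFinP; exact: measurable_dyadic_step.
- by move=> x _; rewrite lee_fin dyadic_step_ge0// => k; exact: saturating_ge0.
- by rewrite lee_fin ltW// weight_seq_gt0.
rewrite integral_dyadic_step; last exact: saturating_ge0.
by rewrite saturating_sum -EFinM [2 ^- j * _]mulrC -mulrA mulfV ?mulr1// expf_neq0.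
Qed.

Lemma saturating_fun_sq_integrable : sq_integrable saturating_fun.
Proof.
have mS := measurable_saturating_series.
apply: sq_integrableP.
  apply: (@measurableT_comp _ _ _ _ _ _ (@Num.sqrt R)).
    by apply: continuous_measurable_fun; exact: sqrt_continuous.
  exact: measurableT_comp.
apply: (@le_lt_trans _ _ (\int[mu]_x saturating_series x)%E); last first.
  exact: le_lt_trans integral_saturating_series (ltry _).
apply: ge0_le_integral => //.
- by move=> x _; rewrite lee_fin sqr_ge0.
- apply/measurable_EFinP/measurable_funX.
  apply: (@measurableT_comp _ _ _ _ _ _ (@Num.sqrt R)).
    by apply: continuous_measurable_fun; exact: sqrt_continuous.
  exact: measurableT_comp.
- move=> x _; rewrite /saturating_fun sqr_sqrtr ?fine_ge0 ?saturating_series_ge0//.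
  by case: (saturating_series x) (saturating_series_ge0 x) => [r| |]//= _; rewrite leey.
Qed.

Lemma ae_saturating_fun_ge j : {ae mu, forall x,
  Num.sqrt (weight_seq j) * dyadic_step j (fun k => Num.sqrt (saturating j k)) x
  <= saturating_fun x}.
Proof.
have Si : mu.-integrable setT saturating_series.
  apply/integrableP; split; first exact: measurable_saturating_series.
  under eq_integral do rewrite gee0_abs ?saturating_series_ge0//.
  exact: le_lt_trans integral_saturating_series (ltry _).
apply: filterS (integrable_ae measurableT Si) => x /(_ I) Sx.
have st0 : 0 <= dyadic_step j (fun k => Num.sqrt (saturating j k)) x.
  by apply: dyadic_step_ge0 => k; exact: sqrtr_ge0.
rewrite -[dyadic_step _ _ _]ger0_norm// -sqrtr_sqr -sqrtrM ?(ltW (weight_seq_gt0 _))//.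
rewrite dyadic_step_sqr /saturating_fun ler_wsqrtr// -lee_fin fineK//.
have -> : dyadic_step j (fun k => Num.sqrt (saturating j k) ^+ 2) x =
    dyadic_step j (saturating j) x.
  by apply: eq_bigr => k _; rewrite sqr_sqrtr// saturating_ge0.
apply: le_trans (nneseries_lim_ge j.+1 (fun n _ _ => term_ge0 n x)).
rewrite big_nat_recr//= leeDr// sume_ge0// => n _; exact: term_ge0.
Qed.

Lemma le_dyadic_mean_ae (f g : measurableTypeR R -> R) j k :
  (forall x, 0 <= f x) -> (forall x, 0 <= g x) ->
  mu.-integrable setT (EFin \o f) -> mu.-integrable setT (EFin \o g) ->
  {ae mu, forall x, f x <= g x} -> dyadic_mean f j k <= dyadic_mean g j k.
Proof.
move=> f0 g0 fi gi fg; rewrite /dyadic_mean ler_wpM2l ?exprn_ge0//.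
have mA : measurable (dyadic_itv j k : set (measurableTypeR R)).
  exact: measurable_dyadic_itv.
have fA := integrableW mA fi; have gA := integrableW mA gi.
apply: fine_le; [exact: integrable_fin_num|exact: integrable_fin_num|].
apply: ae_ge0_le_integral => //.
- by move=> x _; rewrite lee_fin.
- by case/integrableP: fA.
- by move=> x _; rewrite lee_fin.
- by case/integrableP: gA.
- by apply: filterS fg => x fgx _ /=; rewrite lee_fin.
Qed.

(** Almost everywhere [saturating_fun] dominates the square root of the [j]-th term of the series, a
    step function that equals its own means at generation [j]. *)
Lemma saturating_mean j k : (k < 2 ^ j)%N ->
  weight_seq j * saturating j k <= dyadic_mean saturating_fun j k ^+ 2.
Proof.
move=> kj; pose c k := Num.sqrt (weight_seq j) * Num.sqrt (saturating j k).
have c0 i : 0 <= c i by rewrite mulr_ge0 ?sqrtr_ge0.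
have -> : weight_seq j * saturating j k = dyadic_mean (dyadic_step j c) j k ^+ 2.
  rewrite dyadic_mean_step// /c exprMn !sqr_sqrtr ?saturating_ge0//.
  exact/ltW/weight_seq_gt0.
have le : dyadic_mean (dyadic_step j c) j k <= dyadic_mean saturating_fun j k.
  apply: le_dyadic_mean_ae => [x|x|||].
  - exact: dyadic_step_ge0.
  - exact: sqrtr_ge0.
  - exact: sq_integrable_int (dyadic_step_sq_integrable j c).
  - exact: sq_integrable_int saturating_fun_sq_integrable.
  - apply: filterS (ae_saturating_fun_ge j) => x; apply: le_trans.
    rewrite /dyadic_step mulr_sumr le_eqVlt; apply/orP; left; apply/eqP.
    by apply: eq_bigr => i _; rewrite mulrA.
rewrite lerXn2r// nnegrE; [|apply: le_trans le]; by rewrite dyadic_mean_step.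
Qed.

(** Common to (ii) and (iii): [K] is the loss, either [weight_seq j] or the first factor in
    [saturated], and [d] is the bound of [saturating_lower]. *)
Lemma large_of_saturating (f : R -> R) (b c d t x K : R) j :
  sq_integrable f -> unit_itv x -> dyadic_index j x = insert_index (1 - 2 * b) t j ->
  K * saturating j (dyadic_index j x) <= dyadic_mean f j (dyadic_index j x) ^+ 2 ->
  2 `^ (2 * c * j%:R) <= K * d ->
  d <= saturating j (insert_index (1 - 2 * b) t j) -> 0 <= K ->
  large_at f c x j.
Proof.
move=> f2 Ix xt fx Kd dS K0; rewrite /large_at /= (haar_sum_mean _ (sq_integrable_int f2) Ix).
rewrite -(@ler_pXn2r _ 2)// ?nnegrE ?powR_ge0// real_normK ?num_real//.
apply: le_trans fx; rewrite xt; apply: le_trans (ler_wpM2l K0 dS).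
apply: le_trans Kd; rewrite -powR_mulrn ?powR_ge0// -powRrM.
by rewrite le_eqVlt; apply/orP; left; apply/eqP; congr powR; ring.
Qed.

Lemma saturating_liminf (f : R -> R) (b c x : R) : sq_integrable f -> 0 <= b <= 1 / 2 -> c < b ->
  (forall j k, (k < 2 ^ j)%N -> dyadic_mean f j k = dyadic_mean saturating_fun j k) ->
  insertion_set (1 - 2 * b) x ->
  exists J, forall j, (J <= j)%N -> (c%:E <= haar_rate f x j)%E.
Proof.
move=> f2 b01 cb fS [Ix [t It xt]]; have [J HJ] := saturating_lower b01 cb.
exists J.+1 => j Jj; rewrite haar_rate_ge ?(leq_trans _ Jj)//.
apply: (large_of_saturating (K := weight_seq j) f2 Ix (xt j)) (HJ j t (ltnW Jj)) _.
- by rewrite fS ?saturating_mean// dyadic_index_lt.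
(* The cube of [j + 3] is at least the inverse of [weight_seq j]. *)
- rewrite mulrA ler_peMl ?powR_ge0// /weight_seq mulrC ler_pdivlMr ?mul1r ?mulr_gt0//.
  by rewrite -!natrM -natrX ler_nat expnS expnS expn1 mulnA !leq_mul//; lia.
- exact/ltW/weight_seq_gt0.
Qed.

Lemma exists_saturating : exists f : L2 R, {ae mu, forall x, 0 <= f x} /\
  forall b, 0 <= b <= 1 / 2 ->
    hausdorff_dim (E_lim b f) = (1 - 2 * b)%:E /\
    packing_dim (E_lim b f) = (1 - 2 * b)%:E.
Proof.
have [f fS] := L2_of_sq_integrable saturating_fun_sq_integrable.
have f2 := L2_sq_integrable f.
exists f; split.
  by apply: filterS fS => x ->//; exact: sqrtr_ge0.
move=> b b01.
have meanE j k : (k < 2 ^ j)%N -> dyadic_mean f j k = dyadic_mean saturating_fun j k.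
  move=> _; apply: dyadic_mean_ae fS; first exact: sq_integrable_meas.
  exact: sq_integrable_meas saturating_fun_sq_integrable.
have [hH hP] : ((1 - 2 * b)%:E <= hausdorff_dim (E_lim b f))%E /\
    ((1 - 2 * b)%:E <= packing_dim (E_lim b f))%E.
  apply: (dim_lower_bound f2 b01) => x xb sup_le; have [Ix _] := xb.
  split => //; apply: cvg_of_bounds => c cb.
    exact: saturating_liminf cb meanE xb.
  (* If the rate exceeded [c] infinitely often, the limsup would be at least the midpoint [e], hence
     above [b]. *)
  apply: contrapT => H; have := sup_le; rewrite leNgt => /negP; apply.
  have [e /andP[be ec]] : exists e, b < e < c by exists ((b + c) / 2); lra.
  apply: (@lt_le_trans _ _ e%:E); first by rewrite lte_fin.
  apply: limn_esup_ge => d de J; apply: contrapT => K; apply: H; exists J => j Jj.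
  rewrite leNgt; apply/negP => cu; apply: K; exists j => //.
  by apply: le_trans (ltW cu); rewrite lee_fin ltW// (lt_trans de).
split; apply/eqP; rewrite eq_le ?hH ?hP andbT.
  exact: hausdorff_dim_E_minus f2 b01 (@E_lim_minus _ f b).
exact: packing_dim_E_plus f2 b01 (@E_lim_plus _ f b).
Qed.

(* The first factor is a loss of [1 / p.+1] on the growth rate; it makes room for
   a perturbation of small norm in [saturated_dense]. *)
Definition saturated p : set (L2 R) := [set f | exists2 j, (p <= j)%N &
  forall k, (k < 2 ^ j)%N ->
    2 `^ (- (2 / p.+1%:R) * j%:R) * saturating j k <= dyadic_mean f j k ^+ 2].

Lemma L2_dist_lt (f g : L2 R) r : 0 < r ->
  \int[mu]_x ((f x - g x) ^+ 2) < r ^+ 2 -> L2_dist f g < r.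
Proof.
move=> r0; rewrite -L2_dist_sqr => H.
by rewrite -(@ltr_pXn2r _ 2)// ?nnegrE ?(ltW r0)// /L2_dist fine_ge0// Lnorm_ge0.
Qed.

Lemma L2_dist_mean (f g : L2 R) j k : (k < 2 ^ j)%N ->
  (dyadic_mean f j k - dyadic_mean g j k) ^+ 2 <= 2 ^+ j * L2_dist f g ^+ 2.
Proof.
move=> kj; have f2 := L2_sq_integrable f; have g2 := L2_sq_integrable g.
rewrite -dyadic_meanB; [|exact: sq_integrable_int|exact: sq_integrable_int].
by rewrite L2_dist_sqr; apply: dyadic_mean_sqr_le => //; exact: sq_integrableB.
Qed.

Lemma L2_nbhsP (f : L2 R) (A : set (L2 R)) :
  nbhs f A <-> exists2 e, 0 < e & forall g, L2_dist f g < e -> A g.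
Proof.
split=> [/nbhs_ballP[e e0 eA]|[e e0 eA]].
  by exists e => // g fg; apply: eA.
by apply/nbhs_ballP; exists e => // g fg; exact: eA.
Qed.

(** Near [f], a step function of generation [j] added to [f] gives [h] with large means. Only
    finitely many means, continuous for the distance, are constrained, so a whole ball around [h] is
    saturated. *)
Lemma saturated_dense p : dense (interior (saturated p)).
Proof.
move=> U [f Uf] oU.
have /L2_nbhsP[e e0 eU] : nbhs f U by apply: open_nbhs_nbhs.
have f2 := L2_sq_integrable f.
have d0 : 0 < 2 / p.+1%:R :> R by rewrite divr_gt0.
(* 16 (j + 3)^2 / e^2 is the inverse of the square of [eta / 2], the factor left in the final
   bound. *)
have [J HJ] := poly_le_exp 2 d0 (divr_ge0 (ler0n R 16) (sqr_ge0 e)).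
pose j := maxn p J; have {HJ} HJ := HJ j (leq_maxr _ _).
have n0 : 0 < (j + 3)%:R :> R by rewrite ltr0n addnS.
(* The perturbation then has squared norm eta^2 (j + 3) = e^2 / (4 (j + 3)), below e^2. *)
pose eta := e / (2 * (j + 3)%:R); have eta0 : 0 < eta by rewrite divr_gt0// mulr_gt0.
(* A perturbation with the sign of the mean of [f] cannot cancel it. *)
pose c k := (if 0 <= dyadic_mean f j k then eta else - eta) * Num.sqrt (saturating j k).
pose st := dyadic_step j c; have st2 := dyadic_step_sq_integrable j c.
have [h hE] := L2_of_sq_integrable (sq_integrableD f2 st2).
have h2 := L2_sq_integrable h.
have fh : L2_dist f h < e.
  apply: L2_dist_lt => //.
  have -> : \int[mu]_x ((f x - h x) ^+ 2) = \int[mu]_x (st x ^+ 2).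
    congr fine; apply: ae_eq_integral => //.
    - apply/measurable_EFinP/measurable_funX/measurable_funB; exact: measurable_L2.
    - apply/measurable_EFinP/measurable_funX; exact: measurable_dyadic_step.
    - apply: filterS hE => x hx _ /=; congr EFin.
      by rewrite hx//= opprD addrA subrr sub0r sqrrN.
  rewrite Rintegral_dyadic_step_sqr.
  rewrite (eq_bigr (fun k : 'I_(2 ^ j) => eta ^+ 2 * saturating j k)); last first.
    move=> k _; rewrite /c exprMn sqr_sqrtr ?saturating_ge0//.
    by case: ifP => _; rewrite ?sqrrN.
  rewrite -mulr_sumr saturating_sum.
  have -> : 2 ^- j * (eta ^+ 2 * (j.+3%:R * 2 ^+ j)) = e ^+ 2 / (4 * (j + 3)%:R).
    rewrite /eta addn3; field; rewrite expf_neq0//=.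
    by rewrite -addn3 gt_eqF.
  rewrite ltr_pdivrMr ?mulr_gt0// ltr_pMr ?exprn_gt0//.
  by rewrite -natrM ltr1n; lia.
exists h; split; first exact: eU.
have hmean k : (k < 2 ^ j)%N -> eta * Num.sqrt (saturating j k) <= `|dyadic_mean h j k|.
  move=> kj; have -> : dyadic_mean h j k = dyadic_mean f j k + c k.
    rewrite (dyadic_mean_ae _ _ _ _ hE); [|exact: sq_integrable_meas|].
      have := @dyadic_meanB _ (f \+ st) f j k.
      rewrite (_ : (f \+ st) \- f = st); last by apply/funext => x /=; rewrite addrAC subrr add0r.
      rewrite dyadic_mean_step// => ->; first by rewrite addrC subrK.
        exact: sq_integrable_int (sq_integrableD f2 st2).
      exact: sq_integrable_int.
    exact: sq_integrable_meas (sq_integrableD f2 st2).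
  have s0 : 0 <= eta * Num.sqrt (saturating j k) by rewrite mulr_ge0 ?sqrtr_ge0// ltW.
  rewrite /c; case: ifPn => [m0|]; first by rewrite ger0_norm ?addr_ge0// lerDr.
  rewrite -ltNge => m0; rewrite mulNr ler0_norm; last by lra.
  by lra.
have q0 : 0 < 2 ^+ j :> R by rewrite exprn_gt0.
(* Within distance [r] the means of generation [j] move by at most [eta / 2], which is half of the
   lower bound or less because [saturating] is at least 1. *)
pose r := eta / 2 / Num.sqrt (2 ^+ j); have r0 : 0 < r by rewrite !divr_gt0// sqrtr_gt0.
apply/L2_nbhsP; exists r => // g hg; exists j; first exact: leq_maxl.
move=> k kj.
have s1 : 1 <= Num.sqrt (saturating j k : R).
  by have := ler_wsqrtr (@saturating_ge1 R j k); rewrite sqrtr1.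
have dist : `|dyadic_mean h j k - dyadic_mean g j k| <= eta / 2.
  have eta20 : 0 <= eta / 2 by rewrite divr_ge0// ltW.
  rewrite -(@ler_pXn2r _ 2)// ?nnegrE// real_normK ?num_real//.
  apply: le_trans (L2_dist_mean h g kj) _.
  have -> : (eta / 2) ^+ 2 = 2 ^+ j * r ^+ 2.
    rewrite /r [in RHS]exprMn exprVn sqr_sqrtr ?(ltW q0)//.
    by rewrite mulrCA mulfV ?mulr1// gt_eqF.
  rewrite ler_wpM2l ?(ltW q0)// lerXn2r ?nnegrE ?(ltW r0) ?(ltW hg)//.
  by rewrite /L2_dist fine_ge0// Lnorm_ge0.
have gmean : eta / 2 * Num.sqrt (saturating j k) <= `|dyadic_mean g j k|.
  have : `|dyadic_mean h j k| <= `|dyadic_mean g j k| + `|dyadic_mean h j k - dyadic_mean g j k|.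
    by rewrite -lerBlDl; apply: le_trans (lerB_dist _ _) _.
  have : eta / 2 <= eta / 2 * Num.sqrt (saturating j k) by rewrite ler_peMr// divr_ge0// ltW.
  have := hmean _ kj; lra.
apply: (@le_trans _ _ ((eta / 2) ^+ 2 * saturating j k)).
  rewrite ler_wpM2r ?saturating_ge0// mulNr powRN.
  rewrite -[leRHS]invrK lef_pV2 ?posrE ?powR_gt0 ?invr_gt0 ?exprn_gt0 ?divr_gt0//.
  apply: le_trans HJ; rewrite le_eqVlt; apply/orP; left; apply/eqP.
  by rewrite /eta; field; rewrite !gt_eqF.
rewrite -[X in _ * X <= _](sqr_sqrtr (saturating_ge0 j k)) -exprMn -[leRHS]real_normK ?num_real//.
by rewrite lerXn2r ?nnegrE// mulr_ge0 ?sqrtr_ge0// divr_ge0// ltW.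
Qed.

(** As [p] grows, the generations provided are unbounded and the loss 1 / p.+1 on the rate tends to
    0, so the limsup is at least [b] on the whole insertion set. *)
Lemma saturated_E_minus (f : L2 R) b : (forall p, saturated p f) -> 0 <= b <= 1 / 2 ->
  hausdorff_dim (E_minus b f) = (1 - 2 * b)%:E.
Proof.
move=> sf b01; have f2 := L2_sq_integrable f.
apply/eqP; rewrite eq_le; apply/andP; split.
  exact: hausdorff_dim_E_minus f2 b01 (@subset_refl _ _).
suff H x : insertion_set (1 - 2 * b) x -> (limn_esup (haar_rate f x) <= b%:E)%E -> E_minus b f x.
  by have [] := dim_lower_bound f2 b01 H.
move=> xb sup_le.
have [Ix [t It xt]] := xb; split => //; apply/eqP; rewrite eq_le sup_le /=.
apply: limn_esup_ge => c cb J.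
have d0 : 0 < (b - c) / 2 by lra.
have [N HN] := half_exp_small d0.
have [J1 HJ1] : exists J, forall j t, (J <= j)%N ->
  (j + 3)%:R ^+ 3 * 2 `^ (2 * ((b + c) / 2) * j%:R) <= saturating j (insert_index (1 - 2 * b) t j).
  by apply: saturating_lower => //; lra.
(* The three terms give j > J, the validity of [HJ1], and a loss 1 / p.+1 of at most (b - c) / 2,
   the distance from the midpoint to [c]. *)
pose p := (maxn J.+1 (maxn J1 (2 ^ N)))%N.
have [j pj sj] := sf p.
have Jj : (J < j)%N by apply: leq_trans pj; rewrite /p leq_max leqnn.
have J1j : (J1 <= j)%N by apply: leq_trans pj; rewrite /p !leq_max leqnn orbT.
exists j; first exact: ltnW.
rewrite haar_rate_ge ?(leq_trans _ Jj)//.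
apply: (large_of_saturating (K := 2 `^ (- (2 / p.+1%:R) * j%:R)) f2 Ix (xt j)) (HJ1 j t J1j) _.
- by apply: sj; exact: dyadic_index_lt.
- apply: (@le_trans _ _ (2 `^ (- (2 / p.+1%:R) * j%:R) * 2 `^ (2 * ((b + c) / 2) * j%:R))).
    rewrite -powRD; last by rewrite pnatr_eq0 implybT.
    rewrite ler_powR ?ler1n// -mulrDl ler_wpM2r//.
    have : p.+1%:R^-1 <= (b - c) / 2.
      apply: le_trans (ltW HN); rewrite lef_pV2 ?posrE ?exprn_gt0//.
      by rewrite -natrX ler_nat leqW// /p !leq_max leqnn !orbT.
    by move: (p.+1%:R^-1) => i; lra.
  rewrite ler_wpM2l ?powR_ge0// ler_peMl ?powR_ge0// exprn_ege1// ler1n addn3//.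
- exact: powR_ge0.
Qed.

End saturating_functions.

Theorem theorem3p3 (R : realType) :
  (forall (beta : R) (f : L2 R), 0 <= beta <= 1 / 2 ->
     (packing_dim (E_plus beta f) <= (1 - 2 * beta)%:E)%E)
  /\
  (exists f : L2 R,
     {ae lebesgue01 R, forall x, 0 <= f x} /\
     forall beta : R, 0 <= beta <= 1 / 2 ->
       hausdorff_dim (E_lim beta f) = (1 - 2 * beta)%:E /\
       packing_dim (E_lim beta f) = (1 - 2 * beta)%:E)
  /\
  residual [set f : L2 R | forall beta : R, 0 <= beta <= 1 / 2 ->
     hausdorff_dim (E_minus beta f) = (1 - 2 * beta)%:E].
Proof.
split; [|split].
- move=> b f b01; exact: packing_dim_E_plus (L2_sq_integrable f) b01 (@subset_refl _ _).
- exact: exists_saturating.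
- exists (\bigcap_p interior (saturated p)).
    exists (fun p => interior (saturated p)) => // p.
    by split; [exact: open_interior|exact: saturated_dense].
  move=> f sf b b01; apply: saturated_E_minus => // p.
  by apply: interior_subset; exact: sf.
Qed.
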